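(* Let $X,Y,Z$ be locally convex Hausdorff topological vector spaces, $K\subset Y$ a proper closed convex cone with $\operatorname{int}K\neq\emptyset$, and $S\subset Z$ a nonempty convex cone. Let $\Phi\colon X\times Z\to Y^\infty$ be a $K$-convex mapping with $0_Z\in\pi(\operatorname{dom}\Phi)$, where $\pi(x,z)=z$, and let $Z_0=\operatorname{lin}(\pi(\operatorname{dom}\Phi))$ with the induced topology. (i) If $0_Z\in\pi(\operatorname{dom}\Phi)-\operatorname{int}S$ and $\Phi(x,0_Z)\leqq_K\Phi(x,z)$ whenever $(x,z)\in\operatorname{dom}\Phi$ and $z\in S$, then stable strong duality holds for both pairs $(\mathrm P)-(\mathrm D)$ and $(\mathrm P)-(\mathrm D_\ell)$, i.e. $\operatorname{WInf}(\mathrm P^L)=\operatorname{WMax}(\mathrm D^L)$ and $\operatorname{WInf}(\mathrm P^L)=\operatorname{WMax}(\mathrm D_\ell^L)$ for every $L\in\mathcal L(X,Y)$. (ii) Suppose at least one of the following holds: (1) there exist $(\widehat x,\widehat y)\in X\times Y$ and a neighborhood $\widehat V$ of $0_Z$ such that $\Phi(\widehat x,z)\leqq_K\widehat y$ for all $z\in\widehat V\cap Z_0$; (2) there exists $\widehat x\in X$ such that the restriction of $\Phi(\widehat x,\cdot)$ to $Z_0$ is continuous at $0_Z$; (3) $\dim Z_0<\infty$ and $0_Z\in\operatorname{ri}(\pi(\operatorname{dom}\Phi))$; (4) $X,Y$ are complete and first countable, $Z_0$ is barreled, $\Phi$ is $K$-epi closed, and $0_Z\in\operatorname{icr}(\pi(\operatorname{dom}\Phi))$;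 (5) $\Phi(x,0_Z)\leqq_K\Phi(x,z)$ for all $(x,z)\in\operatorname{dom}\Phi$, and $\operatorname{int}(\pi(\operatorname{dom}\Phi))\neq\emptyset$. Then stable strong duality holds for $(\mathrm P)-(\mathrm D)$, i.e. $\operatorname{WInf}(\mathrm P^L)=\operatorname{WMax}(\mathrm D^L)$ for every $L\in\mathcal L(X,Y)$. If, in addition, there exists $\tilde x\in X$ with $(\tilde x,0_Z)\in\operatorname{dom}\Phi$ and $\Phi(\tilde x,z)\leqq_K\Phi(\tilde x,0_Z)$ for all $z\in-S$, then stable strong duality holds for $(\mathrm P)-(\mathrm D_\ell)$ as well, i.e. $\operatorname{WInf}(\mathrm P^L)=\operatorname{WMax}(\mathrm D_\ell^L)$ for every $L\in\mathcal L(X,Y)$.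
   Context: Ordering: $K$ proper means $K\ne Y$. $y_1\leqq_K y_2$ iff $y_1-y_2\in-K$; $y_1<_K y_2$ iff $y_1-y_2\in-\operatorname{int}K$. $Y^\infty=Y\cup\{+\infty_Y\}$, $Y^\bullet=Y\cup\{-\infty_Y,+\infty_Y\}$, where $-\infty_Y<_K y<_K+\infty_Y$ for $y\in Y$, $-\infty_Y<_K+\infty_Y$, $-(\pm\infty_Y)=\mp\infty_Y$, $y+(\pm\infty_Y)=\pm\infty_Y$ for $y\in Y$; in particular $+\infty_Y\not\leqq_K y$ for $y\in Y$. For $M\subset Y^\bullet$: $\operatorname{WSup}M$ is the set of $\bar v\in Y^\bullet$ such that $\bar v\not<_K v$ for all $v\in M$ and for every $\tilde v\in Y^\bullet$ with $\tilde v<_K\bar v$ there is $v\in M$ with $\tilde v<_K v$; $\operatorname{WInf}M=-\operatorname{WSup}(-M)$; $\operatorname{WMax}M=M\cap\operatorname{WSup}M$. $\mathcal L(X,Y)$ is the space of continuous linear maps $X\to Y$. $\operatorname{dom}\Phi=\{(x,z):\Phi(x,z)\neq+\infty_Y\}$; $\Phi$ is $K$-convex (resp. $K$-epi closed) if $\{(x,z,y)\in X\times Z\times Y:y\in\Phi(x,z)+K\}$ is convex (resp. closed). $\Phi^*(L,T)=\operatorname{WSup}\{L(x)+T(z)-\Phi(x,z):(x,z)\in X\times Z\}$ for $(L,T)\in\mathcal L(X,Y)\times\mathcal L(Z,Y)$. $\mathcal L_\Phi=\{T\in\mathcal L(Z,Y):\exists L\in\mathcal L(X,Y),\ \Phi^*(L,T)\neq\{+\infty_Y\}\}$,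 $\mathcal L_+(S,K)=\{T\in\mathcal L(Z,Y):T(S)\subset K\}$, $\mathcal L_\Phi^+=\mathcal L_\Phi\cap\mathcal L_+(S,K)$. Problems, for $L\in\mathcal L(X,Y)$: $\operatorname{WInf}(\mathrm P^L)=\operatorname{WInf}\{\Phi(x,0_Z)-L(x):x\in X\}$; $\operatorname{WMax}(\mathrm D^L)=\operatorname{WMax}M_L$ with $M_L=\bigcup_{T\in\mathcal L_\Phi}(-\Phi^*(L,T))$; $\operatorname{WMax}(\mathrm D^L_\ell)=\operatorname{WMax}M_L^+$ with $M_L^+=\bigcup_{T\in\mathcal L_\Phi^+}(-\Phi^*(L,T))$. $(\mathrm P),(\mathrm D),(\mathrm D_\ell)$ are the problems with $L=0$. In (2), continuity at $0_Z$ means: $\Phi(\widehat x,0_Z)\in Y$ and for every neighborhood $V$ of $\Phi(\widehat x,0_Z)$ in $Y$ there is a neighborhood $N$ of $0_Z$ with $\Phi(\widehat x,z)\in V$ for all $z\in N\cap Z_0$. $\operatorname{lin}$, $\operatorname{aff}$ are linear and affine hulls; $\operatorname{ri}U$ is the interior of $U$ relative to $\operatorname{aff}U$; $\operatorname{icr}U=\{z\in Z:\forall z'\in\operatorname{aff}U\ \exists\delta>0,\ z+\lambda z'\in U\ \forall\lambda\in[0,\delta]\}$. Complete: every Cauchy net converges. Barreled: every absorbing convex closed subset is a neighborhood of the origin.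
   Formalization: The value of a dual problem, WMax M_L or WMax M_L^+, is taken to be {-∞_Y} when M_L (resp. M_L^+) is empty; read literally it would be the empty set and the claimed equality false (e.g. Φ(x,z)=f(x) with f linear and discontinuous). *)

(* Defs.v *)
From HB Require Import structures.
From mathcomp Require Import all_boot all_order all_algebra.
From mathcomp Require Import all_classical all_reals all_analysis.

Set Implicit Arguments.
Unset Strict Implicit.
Unset Printing Implicit Defensive.

Import Order.TTheory GRing.Theory Num.Theory.
Import numFieldNormedType.Exports.

Local Open Scope classical_set_scope.
Local Open Scope ring_scope.

(* A locally convex space is a [tvsType R] with [R : realType].  The uniformity
   carried by a [tvsType] induces its topology but need not be translation
   invariant, so that Cauchy nets are defined below from the neighbourhoods of
   the origin and not with the library's [cauchy]. *)

Section Cones.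
Context {R : realType} {E : lmodType R}.

(* Cones are stable under positive scalars and need not contain the origin. *)
Definition cone (C : set E) : Prop :=
  forall (a : R) (x : E), 0 < a -> C x -> C (a *: x).

Definition convex_cone (C : set E) : Prop := convex_set C /\ cone C.

Definition linear_subspace (V : set E) : Prop :=
  V 0 /\ forall (a : R) (u v : E), V u -> V v -> V (a *: u + v).

Definition affine_subspace (A : set E) : Prop :=
  forall (a : R) (u v : E), A u -> A v -> A (a *: u + (1 - a) *: v).

Definition lin (U : set E) : set E := smallest linear_subspace U.

Definition aff (U : set E) : set E := smallest affine_subspace U.

Definition finite_dim (V : set E) : Prop :=
  exists s : seq E, V = lin [set` s].

Definition icr (U : set E) : set E :=
  [set z | forall z', aff U z' -> exists2 d : R, 0 < d &
     forall l : R, 0 <= l <= d -> U (z + l *: z')].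

Definition absorbing_in (V U : set E) : Prop :=
  forall z, V z -> exists2 d : R, 0 < d &
    forall l : R, `|l| <= d -> U (l *: z).

End Cones.

Section TopologicalNotions.
Context {R : realType} {E : tvsType R}.

Definition ri (U : set E) : set E :=
  [set z | aff U z /\ exists2 N : set E, nbhs z N & N `&` aff U `<=` U].

(* [V] is a linear subspace with the induced topology: its closed subsets and
   the neighbourhoods of its origin are traces on [V]. *)
Definition barreled (V : set E) : Prop :=
  forall U : set E, U `<=` V -> absorbing_in V U -> convex_set U ->
    (exists2 C : set E, closed C & U = C `&` V) ->
    exists2 N : set E, nbhs (0 : E) N & N `&` V `<=` U.

Definition directed (I : Type) (le : I -> I -> Prop) : Prop :=
  [/\ inhabited I, forall i, le i i,
      forall i j k, le i j -> le j k -> le i k &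
      forall i j, exists k, le i k /\ le j k].

Definition cauchy_net (I : Type) (le : I -> I -> Prop) (x : I -> E) : Prop :=
  forall U : set E, nbhs (0 : E) U ->
    exists i0, forall i j, le i0 i -> le i0 j -> U (x i - x j).

Definition net_cvg (I : Type) (le : I -> I -> Prop) (x : I -> E) (l : E)
    : Prop :=
  forall U : set E, nbhs l U -> exists i0, forall i, le i0 i -> U (x i).

Definition net_complete : Prop :=
  forall (I : Type) (le : I -> I -> Prop) (x : I -> E),
    directed le -> cauchy_net le x -> exists l : E, net_cvg le x l.

Definition first_countable : Prop :=
  forall x : E, exists2 N : nat -> set E, (forall n, nbhs x (N n)) &
    forall U : set E, nbhs x U -> exists n, N n `<=` U.

End TopologicalNotions.
Arguments net_complete {R} E.
Arguments first_countable {R} E.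

(* [\bar Y] is Y with -oo and +oo adjoined; the library's order on it is not
   used, the order being the one given by K. *)
Section ExtendedOrder.
Context {R : realType} {Y : tvsType R} (K : set Y).

Definition leK (u v : \bar Y) : Prop :=
  match u, v with
  | EFin y1, EFin y2 => ((fun k : Y => - k) @` K) (y1 - y2)
  | ENInf, _ => True
  | _, EPInf => True
  | _, _ => False
  end.

Definition ltK (u v : \bar Y) : Prop :=
  match u, v with
  | EFin y1, EFin y2 => ((fun k : Y => - k) @` interior K) (y1 - y2)
  | ENInf, EFin _ => True
  | ENInf, EPInf => True
  | EFin _, EPInf => True
  | _, _ => False
  end.

Definition WSup (M : set (\bar Y)) : set (\bar Y) :=
  [set v | (forall w, M w -> ~ ltK v w) /\
           (forall u, ltK u v -> exists2 w, M w & ltK u w)].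

Definition WInf (M : set (\bar Y)) : set (\bar Y) :=
  oppe @` WSup (oppe @` M).

Definition WMax (M : set (\bar Y)) : set (\bar Y) := M `&` WSup M.

(* The value of a maximization problem with set of objective values [M].  It is
   [WMax M], except that an empty problem has value -oo (note that
   [WSup set0] is [set -oo], whereas [WMax set0] is empty).  The exception is
   needed for problems without dual feasible points: if f is a discontinuous
   linear functional on X and Phi (x, z) = f x, then Phi^* is constantly +oo, so
   the dual problem is empty, while the primal value is -oo. *)
Definition WMax_value (M : set (\bar Y)) : set (\bar Y) :=
  if `[< M = set0 >] then [set -oo%E] else WMax M.

End ExtendedOrder.

Section Perturbation.
Context {R : realType} {X Y Z : tvsType R}.
Variables (K : set Y) (S : set Z) (Phi : X * Z -> \bar Y).

Definition domPhi : set (X * Z) := [set p | Phi p <> +oo%E].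

Definition pi_dom : set Z := snd @` domPhi.

Definition epiK : set (X * Z * Y) :=
  [set p | exists2 k : Y, K k & p.2%:E = (Phi p.1 + k%:E)%E].

Definition K_convex : Prop := convex_set epiK.

Definition K_epi_closed : Prop := closed epiK.

Definition conjugate (L : {linear X -> Y}) (T : {linear Z -> Y}) : set (\bar Y) :=
  WSup K [set ((L p.1 + T p.2)%R%:E - Phi p)%E | p in [set: X * Z]].

Definition Lplus : set {linear Z -> Y} :=
  [set T : {linear Z -> Y} | continuous T /\ T @` S `<=` K].

Definition LPhi : set {linear Z -> Y} :=
  [set T : {linear Z -> Y} | continuous T /\
     exists2 L : {linear X -> Y}, continuous L & conjugate L T <> [set +oo%E]].

Definition LPhiplus : set {linear Z -> Y} := LPhi `&` Lplus.

Definition WInfP (L : {linear X -> Y}) : set (\bar Y) :=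
  WInf K [set (Phi (x, 0%R) - (L x)%:E)%E | x in [set: X]].

Definition WMaxD (L : {linear X -> Y}) : set (\bar Y) :=
  WMax_value K (\bigcup_(T in LPhi) (oppe @` conjugate L T)).

Definition WMaxDl (L : {linear X -> Y}) : set (\bar Y) :=
  WMax_value K (\bigcup_(T in LPhiplus) (oppe @` conjugate L T)).

Definition stable_strong_duality_D : Prop :=
  forall L : {linear X -> Y}, continuous L -> WInfP L = WMaxD L.

Definition stable_strong_duality_Dl : Prop :=
  forall L : {linear X -> Y}, continuous L -> WInfP L = WMaxDl L.

Definition Z0 : set Z := lin pi_dom.

Definition cond1 : Prop :=
  exists (x : X) (y : Y), exists2 V : set Z, nbhs (0 : Z) V &
    forall z, (V `&` Z0) z -> leK K (Phi (x, z)) y%:E.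

Definition cond2 : Prop :=
  exists (x : X), exists2 y : Y, Phi (x, 0) = y%:E &
    forall V : set Y, nbhs y V -> exists2 N : set Z, nbhs (0 : Z) N &
      forall z, (N `&` Z0) z -> (EFin @` V) (Phi (x, z)).

Definition cond3 : Prop := finite_dim Z0 /\ ri pi_dom 0.

Definition cond4 : Prop :=
  [/\ net_complete X /\ net_complete Y, first_countable X /\ first_countable Y,
      barreled Z0, K_epi_closed & icr pi_dom 0].

Definition cond5 : Prop :=
  (forall x z, domPhi (x, z) -> leK K (Phi (x, 0)) (Phi (x, z))) /\
  interior pi_dom !=set0.

End Perturbation.

(* Main.v *)
(* A finite primal infimum [y] is not strictly above any primal value.  Fix an
   interior direction [k] of [K].  The pairs [(z, t)] such that [y + t k] lies
   strictly above some value of [Phi (x, z) - L x] form a convex set over whose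
   fibre at [z = 0] only [t >= 0] occurs, so that the cone it generates has, by
   Hahn-Banach, a linear minorant [h] as soon as it lies over enough points.
   Then [T z = h z *: k] attains [y] in the dual problem: the separation takes
   place in [Z x R], and no functional on [Y] is needed.  The conditions of the
   theorem only serve to make [h] continuous, and the condition on [S] makes it
   nonnegative on [S]. *)

Require Import Defs.
From HB Require Import structures.
From mathcomp Require Import all_boot all_order all_algebra.
From mathcomp Require Import all_classical all_reals all_analysis.
From mathcomp Require Import ring lra.
Set Implicit Arguments.
Unset Strict Implicit.
Unset Printing Implicit Defensive.
Import Order.TTheory GRing.Theory Num.Theory.
Import numFieldNormedType.Exports.
Local Open Scope classical_set_scope.
Local Open Scope ring_scope.

(** A weak infimum is a set of points, so the duality is an equality of sets. It reduces to
    attaining the finite points of the primal infimum: a finite point with no primal value strictly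
    below it can be raised along [K] to an infimum, so a dual maximum that failed to be a primal
    infimum would lie strictly below an attained dual value. The obstacle is that the cone of values
    may lie over a part of [Z] only, while Hahn-Banach asks for a point over every [z]. Part (i)
    fills the space by subtracting [S]. Under (1), (2) and (4) a single height works over a
    neighbourhood of 0 in [Z0], and adding the epigraph of a multiple of a gauge fills the space and
    gives continuity at the same time. Under (3) the cone is pulled back along a linear projection
    onto [Z0]. Under (5) the zero functional is already a minorant. In (4) the bound comes from the
    Robinson-Ursescu theorem for the relation between the pairs [(x, v)] of the epigraph and [z].
    There [x] varies with [z], so the boundedness lemma fixes only a height and no point [x]. *)

Section LinearCombinations.
Context {R : comPzRingType} {V : lmodType R}.

(** Syntax for proving module identities by reflection; an atom is a position in a list of
    vectors. *)
Inductive lincomb :=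
  | LAtom of nat | LZero | LAdd of lincomb & lincomb | LOpp of lincomb
  | LScale of R & lincomb.

Fixpoint lincomb_eval (env : seq V) (e : lincomb) : V :=
  match e with
  | LAtom n => env`_n
  | LZero => 0
  | LAdd e1 e2 => lincomb_eval env e1 + lincomb_eval env e2
  | LOpp e1 => - lincomb_eval env e1
  | LScale a e1 => a *: lincomb_eval env e1
  end.

(** [Nat.eqb] is used so that [cbn] decides the comparison of two numerals and leaves only
    identities between scalars. *)
Fixpoint lincomb_coef (e : lincomb) (i : nat) : R :=
  match e with
  | LAtom n => if Nat.eqb n i then 1 else 0
  | LZero => 0
  | LAdd e1 e2 => lincomb_coef e1 i + lincomb_coef e2 i
  | LOpp e1 => - lincomb_coef e1 i
  | LScale a e1 => a * lincomb_coef e1 i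
  end.

Fixpoint same_coefs (e1 e2 : lincomb) (n : nat) : Prop :=
  if n is n'.+1 then
    lincomb_coef e1 n' = lincomb_coef e2 n' /\ same_coefs e1 e2 n'
  else True.

Lemma lincomb_evalE env e :
  lincomb_eval env e = \sum_(i < size env) lincomb_coef e i *: env`_i.
Proof.
elim: e => [n||e1 IH1 e2 IH2|e IH|a e IH] /=.
- have nE i : Nat.eqb n i = (n == i) by apply/PeanoNat.Nat.eqb_spec/eqP.
  have [n_lt|n_ge] := ltnP n (size env).
    rewrite (bigD1 (Ordinal n_lt))//= nE eqxx scale1r big1 ?addr0// => i ni.
    by rewrite nE ifN ?scale0r// eq_sym.
  rewrite nth_default// big1// => i _; rewrite nE ifN ?scale0r//.
  by rewrite gtn_eqF// (leq_trans (ltn_ord i)).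
- by rewrite big1// => i _; rewrite scale0r.
- by rewrite IH1 IH2 -big_split; apply: eq_bigr => i _; rewrite scalerDl.
- by rewrite IH -sumrN; apply: eq_bigr => i _; rewrite scaleNr.
- by rewrite IH scaler_sumr; apply: eq_bigr => i _; rewrite scalerA.
Qed.

Lemma lincomb_eq env e1 e2 : same_coefs e1 e2 (size env) ->
  lincomb_eval env e1 = lincomb_eval env e2.
Proof.
move=> e12; rewrite !lincomb_evalE; apply: eq_bigr => -[i lti] _ /=.
congr (_ *: _); elim: (size env) lti e12 => // n IH.
rewrite ltnS leq_eqVlt => /predU1P[->|lti] [e12n e12] //; exact: IH.
Qed.

End LinearCombinations.

Ltac lincomb_mem x l :=
  match l with
  | nil => constr:(false)
  | x :: _ => constr:(true)
  | _ :: ?l' => lincomb_mem x l'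
  end.

Ltac lincomb_index x l :=
  match l with
  | x :: _ => constr:(0%N)
  | _ :: ?l' => let n := lincomb_index x l' in constr:(n.+1)
  end.

Ltac lincomb_atoms e l :=
  match e with
  | ?a + ?b => let l' := lincomb_atoms a l in lincomb_atoms b l'
  | - ?a => lincomb_atoms a l
  | _ *: ?a => lincomb_atoms a l
  | 0 => l
  | _ => match lincomb_mem e l with
         | true => l
         | false => constr:(e :: l)
         end
  end.

Ltac lincomb_reify R e l :=
  match e with
  | ?a + ?b => let a' := lincomb_reify R a l in
               let b' := lincomb_reify R b l in constr:(@LAdd R a' b')
  | - ?a => let a' := lincomb_reify R a l in constr:(@LOpp R a')
  | ?r *: ?a => let a' := lincomb_reify R a l in constr:(@LScale R r a')
  | 0 => constr:(@LZero R)
  | _ => let n := lincomb_index e l in constr:(@LAtom R n)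
  end.

(* Reduces an identity in the [R]-module [V] to the equality of the
   coefficients of each atom. *)
Ltac lincomb R V :=
  match goal with |- @eq _ ?x ?y =>
    let l := lincomb_atoms x (@nil V) in
    let l := lincomb_atoms y l in
    let x' := lincomb_reify R x l in
    let y' := lincomb_reify R y l in
    apply: (@lincomb_eq R V l x' y');
    cbn [lincomb_coef same_coefs size Nat.eqb];
    do ?[apply: conj => //]
  end.

(** * Hahn-Banach for cones *)

Lemma linear_exists (R : pzRingType) (U V : lmodType R) (f : U -> V) :
  linear f -> exists F : {linear U -> V}, F = f :> (U -> V).
Proof.
move=> lf; pose F : {linear U -> V} :=
  HB.pack f (GRing.isLinear.Build _ _ _ _ f lf).
by exists F.
Qed.

Section HahnBanach.
Context {R : realType} {V : lmodType R}.
Implicit Types (G A : set (V * R)) (u v : V) (s t : R).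

(** Convex cones that avoid the open negative half-axis over 0. Any set with a linear minorant
    satisfies the last clause, since the minorant vanishes at 0. *)
Definition above_cone G :=
  [/\ forall u s v t, G (u, s) -> G (v, t) -> G (u + v, s + t),
      forall a u s, 0 < a -> G (u, s) -> G (a *: u, a * s) &
      forall t, G (0, t) -> 0 <= t].

Lemma maximal_above_cone G : above_cone G -> G !=set0 ->
  exists A, [/\ above_cone A, G `<=` A &
    forall B, above_cone B -> A `<=` B -> B `<=` A].
Proof.
(* The union of the empty chain is empty, so containing [G] can only be demanded of a nonempty
   [A]. *)
move=> coneG [g Gg]; pose P A := (A !=set0 -> G `<=` A) /\ above_cone A.
have [|A [[GA coneA] Amax]] := @Zorn_bigcup _ P.
  move=> F FP Ftot; split.
    move=> [p [X FX Xp]] q Gq; exists X => //.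
    by apply: (FP _ FX).1 => //; exists p.
  split.
  - move=> u s v t [X FX Xu] [Y FY Yv].
    have [XY|YX] := Ftot _ _ FX FY.
      by exists Y => //; have [+ _ _] := (FP _ FY).2; apply=> //; exact: XY.
    by exists X => //; have [+ _ _] := (FP _ FX).2; apply=> //; exact: YX.
  - move=> a u s a0 [X FX Xu]; exists X => //.
    by have [_ + _] := (FP _ FX).2; apply.
  - by move=> t [X FX Xt]; have [_ _] := (FP _ FX).2; apply.
have A0 : A !=set0.
  apply: contrapT => /nonemptyPn A0; apply: (Amax G); last by split=> [_ ?|].
  by rewrite A0; split => [//|/(_ g Gg)].
exists A; split => //; first exact: GA.
move=> B coneB AB; apply: contrapT => nBA; apply: (Amax B) => //.
by split => // _; apply: (subset_trans _ AB); exact: GA.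
Qed.

(* A maximal cone [A] is the epigraph of its infimum function [p]: adjoining
   the ray through [(- v, - p v)] gives again a cone of the same kind, so that
   [p] is linear. *)
Lemma hahn_banach_above_cone G : above_cone G ->
  (forall v, exists t, G (v, t)) ->
  exists2 h : V -> R, scalar h & forall v t, G (v, t) -> h v <= t.
Proof.
move=> coneG totG; have [t0 Gt0] := totG 0.
have [|A [[AD AZ A0] GA Amax]] := maximal_above_cone coneG; first by exists (0, t0).
have totA v : exists t, A (v, t) by have [t /GA] := totG v; exists t.
pose p v := inf [set t | A (v, t)].
have inf_p v : has_inf [set t | A (v, t)].
  split; first by have [t At] := totA v; exists t.
  have [s As] := totA (- v); exists (- s) => t /= At.
  by rewrite -subr_ge0 opprK; apply: A0; rewrite -(subrr v); exact: AD.
have p_le v t : A (v, t) -> p v <= t.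
  by move=> At; apply: ge_inf => //; have [] := inf_p v.
have p_ge v m : (forall t, A (v, t) -> m <= t) -> m <= p v.
  by move=> Am; apply: lb_le_inf => //; have [] := inf_p v.
have key v u t : A (u, t) -> A (u - v, t - p v).
  pose B := [set q : V * R | exists l w s,
    [/\ 0 <= l, A (w, s) & q = (w - l *: v, s - l * p v)]].
  move=> At; apply: (Amax B); last by exists 1, u, t; rewrite scale1r mul1r.
    split.
    - move=> _ _ _ _ [l [w [s [l0 Aw [-> ->]]]]] [l' [w' [s' [l'0 Aw' [-> ->]]]]].
      exists (l + l'), (w + w'), (s + s'); split; [exact: addr_ge0|exact: AD|].
      by rewrite scalerDl mulrDl !opprD; congr (_, _); exact: addrACA.
    - move=> a _ _ a0 [l [w [s [l0 Aw [-> ->]]]]].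
      exists (a * l), (a *: w), (a * s); split; [|exact: AZ|].
        by rewrite mulr_ge0// ltW.
      by rewrite scalerBr scalerA mulrBr mulrA.
    - move=> _ [l [w [s [l0 Aw [/esym/eqP]]]]] + ->.
      rewrite subr_eq0 => /eqP wlv.
      move: l0; rewrite le_eqVlt => /predU1P[l0|l0].
        move: Aw; rewrite wlv -l0 scale0r mul0r subr0; exact: A0.
      rewrite subr_ge0 -ler_pdivlMl//; apply: p_le.
      have := AZ l^-1 _ _ _ Aw; rewrite invr_gt0 => /(_ l0).
      by rewrite wlv scalerA mulVf ?gt_eqF// scale1r.
  move=> [w s] Aw; exists 0, w, s; split => //.
  by rewrite scale0r mul0r !subr0.
have p0 : p 0 = 0.
  apply/le_anti/andP; split; last exact/p_ge/A0.
  have [t At] := totA 0; have t_ge0 := A0 _ At.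
  apply/ler_addgt0Pl => e e0; rewrite addr0.
  have t1 : 0 < t + 1 by rewrite ltr_wpDl.
  have := AZ (e / (t + 1)) _ _ (divr_gt0 e0 t1) At.
  rewrite scaler0 => /p_le/le_trans.
  by apply; rewrite -mulrA ler_piMr ?(ltW e0)// mulrC ler_pdivrMr// mul1r lerDl.
have pB u v : p (u - v) <= p u - p v.
  by rewrite lerBrDr; apply: p_ge => t At; rewrite -lerBrDr; exact/p_le/key.
have pD u v : p (u + v) <= p u + p v.
  rewrite -lerBlDr; apply: (p_ge) => s As; rewrite lerBlDr -lerBlDl.
  by apply: p_ge => t At; rewrite lerBlDl; exact/p_le/AD.
have pN v : p (- v) = - p v.
  apply/le_anti/andP; split; first by have := pB 0 v; rewrite p0 !sub0r.
  by rewrite -sub0r lerBlDl -p0 -(subrr v); exact: pD.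
have p_add u v : p (u + v) = p u + p v.
  apply/le_anti; rewrite pD/= -lerBrDr.
  by have := pB (u + v) v; rewrite addrK.
have pZ_le a v : 0 < a -> p (a *: v) <= a * p v.
  move=> a0; rewrite -ler_pdivrMl//; apply: p_ge => t At.
  by rewrite ler_pdivrMl//; exact/p_le/AZ.
have pZ a v : 0 < a -> p (a *: v) = a * p v.
  move=> a0; apply/le_anti; rewrite pZ_le//=.
  have := @pZ_le a^-1 (a *: v); rewrite invr_gt0 => /(_ a0).
  by rewrite scalerA mulVf ?gt_eqF// scale1r ler_pdivlMl.
exists p; last by move=> v t /GA/p_le.
move=> a u v; rewrite p_add; congr (_ + _).
have [a0|a0|->] := ltgtP a 0; [|exact: pZ|by rewrite scale0r p0 mul0r].
apply: oppr_inj; rewrite -pN -scaleNr pZ ?oppr_gt0//; exact: mulNr.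
Qed.

End HahnBanach.

(** * Locally convex spaces *)

Section ConvexSets.
Context {R : realType} {E : lmodType R}.
Implicit Types (A : set E) (x y : E) (a b r : R).

Lemma convex_setP A : convex_set A <->
  forall a x y, 0 <= a <= 1 -> A x -> A y -> A (a *: x + (1 - a) *: y).
Proof.
split=> [cA a x y /andP[a0 a1] Ax Ay|cA x y l /set_mem Ax /set_mem Ay]; last first.
  by apply/mem_set/cA => //; apply/andP; split; [exact: ge0|exact: le1].
have a01 : Itv.spec (@Itv.num_sem R) (Itv.Real `[0%Z, 1%Z]) a.
  by rewrite /= /Itv.num_sem/= num_real/= in_itv/= a0 a1.
by have := cA x y (Itv.mk a01) (mem_set Ax) (mem_set Ay); rewrite inE.
Qed.

(** Subadditivity of the Minkowski gauge of [A], expressed without forming the gauge. *)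
Lemma convex_gaugeD A r1 r2 x y : convex_set A -> 0 < r1 -> 0 < r2 ->
  A (r1^-1 *: x) -> A (r2^-1 *: y) -> A ((r1 + r2)^-1 *: (x + y)).
Proof.
move=> /convex_setP cA r10 r20 Ax Ay; have r0 : 0 < r1 + r2 by exact: addr_gt0.
have /cA/(_ Ax Ay) : 0 <= r1 / (r1 + r2) <= 1.
  by rewrite divr_ge0 ?(ltW r10) ?(ltW r0)//= ler_pdivrMr// mul1r lerDl ltW.
rewrite !scalerA mulrAC divff ?gt_eqF// mul1r scalerDr.
congr (A (_ + _ *: _)).
by field; rewrite !gt_eqF.
Qed.

Lemma convex_scale A a x : convex_set A -> A 0 -> 0 <= a <= 1 -> A x ->
  A (a *: x).
Proof.
move=> /convex_setP cA A0 a01 Ax; have := cA _ _ _ a01 Ax A0.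
by rewrite scaler0 addr0.
Qed.

Lemma convex_coneD A x y : convex_cone A -> A x -> A y -> A (x + y).
Proof.
move=> [/convex_setP cA coneA] Ax Ay.
have := cA 2^-1 x y; rewrite invr_ge0 ler0n invf_le1// ler1n => /(_ isT Ax Ay).
have -> : 1 - 2^-1 = 2^-1 :> R by field.
rewrite -scalerDr => /(coneA 2 _ (ltr0Sn _ _)).
by rewrite scalerA divff ?scale1r// pnatr_eq0.
Qed.

End ConvexSets.

Section TvsBasics.
Context {R : realType} {E : tvsType R}.
Implicit Types (U V : set E) (x y z : E).

Lemma nbhs0_convex_sym U : nbhs 0 U -> exists V,
  [/\ nbhs 0 V, V `<=` U, convex_set V & forall x, V x -> V (- x)].
Proof.
move=> U0; have [B Bc [Bo Bb]] := @locally_convex R E.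
have [W [BW W0] WU] := Bb 0 U U0.
have /convex_setP cW := Bc _ (mem_set BW).
have nW : nbhs 0 W by apply: open_nbhs_nbhs; split => //; exact: Bo.
exists (W `&` -%R @` W); split.
- by apply: filterI => //; exact: nbhs0N.
- by move=> x [/WU].
- apply/convex_setP => a x y a01 [Wx [x' Wx' x'E]] [Wy [y' Wy' y'E]].
  split; first exact: cW.
  exists (a *: x' + (1 - a) *: y'); first exact: cW.
  by rewrite opprD -!scalerN x'E y'E.
- by move=> x [Wx [x' Wx' x'E]]; split; [rewrite -x'E opprK|exists x].
Qed.

Lemma nbhs_shift U x : nbhs x U -> nbhs 0 [set v | U (x + v)].
Proof.
move=> /(nbhsB (- x)); rewrite addNr; apply: filterS => _ [u Uu <-] /=.
by rewrite addNKr.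
Qed.

Lemma nbhs_unshift U x : nbhs 0 [set v | U (x + v)] -> nbhs x U.
Proof. by move=> /(nbhsT x); apply: filterS => _ [u Uu <-]. Qed.

Lemma nbhs0_scale U a : a != 0 -> nbhs 0 U -> nbhs 0 [set v | U (a *: v)].
Proof.
move=> a0 /(nbhs0Z (invr_neq0 a0)); apply: filterS => _ [u Uu <-] /=.
by rewrite scalerA divff// scale1r.
Qed.

Lemma nbhs0_absorbing U z : nbhs 0 U ->
  exists2 d : R, 0 < d & forall l, `|l| <= d -> U (l *: z).
Proof.
move=> U0; have /= := @scale_continuous R E (0, z) U.
rewrite scale0r => /(_ U0)[[/= A B] [A0 Bz] AB].
have [e /= e0 eA] := A0; exists (e / 2); first by rewrite divr_gt0.
move=> l le; apply: (AB (l, z)); split => /=; last exact: nbhs_singleton.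
apply: eA => /=; rewrite sub0r normrN (le_lt_trans le)//.
by rewrite ltr_pdivrMr// ltr_pMr// ltr1n.
Qed.

(** On a symmetric neighbourhood an upper bound is a bound in absolute value, and scaling the
    neighbourhood makes it small. The bound [M + 1] keeps the scaling factor positive when [M] is
    0. *)
Lemma bounded_above_scalar_continuous (h : E -> R) U (M : R) : scalar h ->
  nbhs 0 U -> (forall v, U v -> h v <= M) -> continuous (h : E -> R^o).
Proof.
move=> hs U0 UM; have [V [V0 VU _ VN]] := nbhs0_convex_sym U0.
have h0 : h 0 = 0.
  by have := hs (-1) 0 0; rewrite scaler0 addr0 mulN1r addNr.
have hZ a v : h (a *: v) = a * h v by rewrite -[_ *: _]addr0 hs h0 addr0.
have hB u v : h (u + v) = h u + h v by rewrite -[u]scale1r hs mul1r scale1r.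
have M0 : 0 <= M by rewrite -h0; apply: UM; apply: VU; exact: nbhs_singleton.
have hV v : V v -> `|h v| <= M.
  move=> Vv; rewrite ler_norml lerNl -mulN1r -hZ scaleN1r.
  by apply/andP; split; apply: UM; apply: VU => //; exact: VN.
move=> x; apply/(@cvgrPdist_lt _ R^o) => e e0.
have M1 : 0 < M + 1 by rewrite ltr_wpDl.
have d0 : (M + 1) / e != 0 by rewrite gt_eqF// divr_gt0.
apply: nbhs_unshift; apply: filterS (nbhs0_scale d0 V0) => v /= /hV.
rewrite hB hZ opprD addNKr normrN normrM gtr0_norm ?divr_gt0// => hv.
have : (M + 1) / e * `|h v| < M + 1 by rewrite (le_lt_trans hv)// ltrDl.
by rewrite mulrAC ltr_pdivrMr// ltr_pM2l.
Qed.

End TvsBasics.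

Section ScalarFunctions.
Context {R : realType} {E : lmodType R}.
Variables (h : E -> R) (h_scalar : scalar h).

Lemma scalar_fun0 : h 0 = 0.
Proof. by have := h_scalar (-1) 0 0; rewrite scaler0 addr0 mulN1r addNr. Qed.

Lemma scalar_funZ a v : h (a *: v) = a * h v.
Proof. by rewrite -[_ *: _]addr0 h_scalar scalar_fun0 addr0. Qed.

Lemma scalar_funD u v : h (u + v) = h u + h v.
Proof. by rewrite -[u]scale1r h_scalar mul1r scale1r. Qed.

Lemma scalar_funN v : h (- v) = - h v.
Proof. by rewrite -scaleN1r scalar_funZ mulN1r. Qed.

Lemma scalar_funB u v : h (u - v) = h u - h v.
Proof. by rewrite scalar_funD scalar_funN. Qed.

End ScalarFunctions.

Section LinearHulls.
Context {R : realType} {E : lmodType R}.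
Implicit Types (U F : set E).

Lemma lin_subspace U : linear_subspace (lin U).
Proof.
split=> [F [[]]//|a u v linu linv F FU]; have [[_ Flin] _] := FU.
by apply: Flin; [exact: linu|exact: linv].
Qed.

Lemma sub_lin U : U `<=` lin U.
Proof. by move=> u Uu F [_]; apply. Qed.

Lemma subspaceZ F a v : linear_subspace F -> F v -> F (a *: v).
Proof. by move=> [F0 Flin] Fv; rewrite -[_ *: _]addr0; exact: Flin. Qed.

(** Affine combinations with the origin give all multiples, and twice a midpoint gives sums. *)
Lemma lin_sub_aff U : aff U 0 -> lin U `<=` aff U.
Proof.
move=> aff0; have affA a u v : aff U u -> aff U v -> aff U (a *: u + (1 - a) *: v).
  by move=> Au Av A AU; have [+ _] := AU; apply; [exact: Au|exact: Av].
have affZ a u : aff U u -> aff U (a *: u).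
  by move=> Au; have := affA a _ _ Au aff0; rewrite scaler0 addr0.
apply: smallest_sub; last by move=> u Uu A [_]; apply.
split=> // a u v Au Av.
have := affZ 2 _ (affA 2^-1 _ _ (affZ a _ Au) Av).
by have -> : 2 *: (2^-1 *: (a *: u) + (1 - 2^-1) *: v) = a *: u + v
  by lincomb R E; field.
Qed.

End LinearHulls.

Section ContinuousMinorants.
Context {R : realType} {E : tvsType R}.

(* Adding to [G] the epigraph of a multiple of the gauge of [V] yields a cone
   that lies over the whole space, and whose minorants are bounded on [V]. *)
Lemma continuous_minorant (G : set (E * R)) (F V : set E) (M : R) :
  above_cone G -> linear_subspace F -> (forall v t, G (v, t) -> F v) ->
  nbhs 0 V -> (forall v, V v -> F v -> G (v, M)) ->
  exists h : E -> R, [/\ scalar h, continuous (h : E -> R^o) &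
    forall v t, G (v, t) -> h v <= t].
Proof.
move=> [GD GZ G0] [F0 Flin] GF V0 VM.
have FZ a v : F v -> F (a *: v) by move=> Fv; rewrite -[_ *: _]addr0; exact: Flin.
have [W [W0 WV cW WN]] := nbhs0_convex_sym V0.
have W00 : W 0 by exact: nbhs_singleton.
have GM : G (0, M) by apply: VM => //; exact: WV.
have M0 := G0 _ GM.
pose G' := [set q : E * R | exists v t r w,
  [/\ G (v, t), 0 < r, W (r^-1 *: w) & q = (v + w, t + r * M)]].
have coneG' : above_cone G'.
  split.
  - move=> _ _ _ _ [v [t [r [w [Gv r0 Ww [-> ->]]]]]]
      [v' [t' [r' [w' [Gv' r'0 Ww' [-> ->]]]]]].
    exists (v + v'), (t + t'), (r + r'), (w + w'); split.
    + exact: GD.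
    + exact: addr_gt0.
    + exact: convex_gaugeD.
    + by congr (_, _); [exact: addrACA|rewrite mulrDl; exact: addrACA].
  - move=> a _ _ a0 [v [t [r [w [Gv r0 Ww [-> ->]]]]]].
    exists (a *: v), (a * t), (a * r), (a *: w); split.
    + exact: GZ.
    + exact: mulr_gt0.
    + by rewrite scalerA invfM mulrAC mulVf ?gt_eqF// mul1r.
    + by rewrite scalerDr mulrDr mulrA.
  (* Over 0 one has [w = - v], which lies in [F]; there the hypothesis on [V] replaces the gauge
     term by a point of [G]. *)
  - move=> _ [v [t [r [w [Gv r0 Ww [/esym/eqP]]]]]] + ->.
    rewrite addr_eq0 => /eqP vw; apply: G0.
    have Fw : F w by rewrite -[w]opprK -vw -scaleN1r; apply: FZ; exact: GF Gv.
    have := VM _ (WV _ Ww) (FZ _ _ Fw) => /(GZ _ _ _ r0).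
    rewrite scalerA divff ?gt_eqF// scale1r => /(GD _ _ _ _ Gv).
    by rewrite vw addNr.
have totG' v : exists t, G' (v, t).
  have [d d0 dW] := nbhs0_absorbing v W0.
  exists (M + d^-1 * M), 0, M, d^-1, v; split => //; rewrite ?invr_gt0 ?add0r//.
  by rewrite invrK; apply: dW; rewrite gtr0_norm.
have [h hs hG'] := hahn_banach_above_cone coneG' totG'.
exists h; split => //.
  apply: (bounded_above_scalar_continuous (M := M + 1 * M) hs W0) => w Ww.
  by apply: hG'; exists 0, M, 1, w; rewrite invr1 scale1r add0r.
(* The gauge parameter [r] is strictly positive, so [G'] contains points of [G] only up to an
   arbitrarily small rise; [r = e / (M + 1)] makes this rise at most [e]. *)
move=> v t Gv; apply/ler_addgt0Pl => e e0.
have M1 : 0 < M + 1 by rewrite ltr_wpDl.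
have /hG'/le_trans : G' (v, t + e / (M + 1) * M).
  by exists v, t, (e / (M + 1)), 0; rewrite scaler0 addr0 divr_gt0.
apply; rewrite addrC lerD2r -mulrA ler_piMr ?(ltW e0)//.
by rewrite mulrC ler_pdivrMr// mul1r lerDl.
Qed.

(** The functional sending [a *: v] to [a] on the line through [v] is bounded by 1 on a convex
    symmetric neighbourhood that misses [v], so its epigraph has a continuous linear minorant.
    Evaluating the minorant at [v] and at [- v] gives both inequalities. *)
Lemma separate_point (v : E) : hausdorff_space E -> v != 0 ->
  exists h : E -> R, [/\ scalar h, continuous (h : E -> R^o) & h v = 1].
Proof.
rewrite open_hausdorff => hE v0.
have [[A B] /= [vA B0] [_ oB AB]] := hE _ _ v0.
have nB : nbhs 0 B by apply: open_nbhs_nbhs; split=> //; apply/set_mem.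
have [V [V0 VB cV VN]] := nbhs0_convex_sym nB.
have nVv : ~ V v.
  move=> /VB Bv; suff : (A `&` B) v by rewrite (eqP AB).
  by split => //; exact/set_mem.
have a_lt1 a : V (a *: v) -> `|a| <= 1.
  move=> Vav; rewrite leNgt; apply/negP => a1; apply: nVv.
  have a0 : a != 0 by rewrite -normr_gt0 (lt_trans _ a1).
  have V' : V (`|a| *: v).
    by have [_|_] := ger0P a; rewrite ?scaleNr; [|exact: VN].
  have := convex_scale (a := `|a|^-1) cV (nbhs_singleton V0) _ V'.
  rewrite scalerA mulVf ?normr_eq0// scale1r; apply.
  by rewrite invr_ge0 normr_ge0 invf_le1 ?normr_gt0// ltW.
have inj a : a *: v = 0 -> a = 0.
  by move=> /eqP; rewrite scaler_eq0 (negbTE v0) orbF => /eqP.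
pose G := [set q : E * R | exists2 a, q.1 = a *: v & a <= q.2].
have [||||h [hs hc hG]] :=
  @continuous_minorant G [set u | exists a, u = a *: v] V 1 _ _ _ V0 _.
- split => /=.
  + move=> u s w t [a /= -> sa] [b /= -> tb]; exists (a + b) => /=.
      by rewrite scalerDl.
    exact: lerD.
  + move=> c u s c0 [a /= -> sa]; exists (c * a); rewrite /= ?scalerA//.
    by rewrite ler_pM2l.
  + by move=> t [a /= /esym/inj ->].
- split; first by exists 0; rewrite scale0r.
  by move=> c u w [a ->] [b ->]; exists (c * a + b); rewrite scalerDl scalerA.
- by move=> u t [a /= -> _]; exists a.
- move=> u Vu [a uE]; exists a => //=; apply: le_trans (ler_norm _) _.
  by apply: a_lt1; rewrite -uE.
exists h; split => //; apply/le_anti/andP; split.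
  by apply: hG; exists 1; rewrite /= ?scale1r.
rewrite -lerN2 -(scalar_funN hs); apply: hG; exists (-1) => //=.
by rewrite scaleN1r.
Qed.

(* Every linear functional agrees on a finite-dimensional subspace with a
   continuous one, namely with its composite with [P]. *)
Lemma finite_dim_projector (s : seq E) : hausdorff_space E ->
  exists P : E -> E, [/\ linear P,
    forall h : E -> R, scalar h -> continuous (h \o P : E -> R^o),
    forall v, v \in s -> P v = v & forall v, lin [set` s] (P v)].
Proof.
move=> hE; elim: s => [|e s [P [Pl Pc Ps Plin]]].
  exists (fun=> 0); split => //; first by move=> a u v; rewrite scaler0 addr0.
    by move=> h _ x; exact: cvg_cst.
  by move=> _ F [[]].
have Plin' v : lin [set` e :: s] (P v).
  move=> F [Flin sF]; apply: Plin; split => // u us.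
  by apply: sF; rewrite /= inE us orbT.
have e_lin : lin [set` e :: s] e.
  by move=> F [_]; apply; rewrite /= mem_head.
have [eE|e'0] := eqVneq (e - P e) 0.
  exists P; split => // v; rewrite inE => /predU1P[->|/Ps//].
  by apply/esym/eqP; rewrite -subr_eq0 eE.
have [g [gs gc ge]] := separate_point hE e'0.
(* A rank-one correction of [P]: [k] vanishes where [P] is already the identity and equals 1 at
   [e]. *)
pose k v := g (v - P v).
have ks : scalar k.
  move=> a u v; rewrite /k Pl -gs; congr g.
  by rewrite scalerBr opprD addrACA.
exists (fun v => P v + k v *: (e - P e)); split.
- move=> a u v; rewrite Pl ks scalerDl -scalerA [a *: (_ + _)]scalerDr.
  exact: addrACA.
- move=> h hs.
  have -> : h \o (fun v => P v + k v *: (e - P e)) =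
      (fun v => (h \o P) v + (g v - (g \o P) v) * h (e - P e)).
    apply/funext => v /=.
    by rewrite (scalar_funD hs) (scalar_funZ hs) /k (scalar_funB gs).
  move=> x; apply: (@cvgD _ R^o); first exact: Pc.
  apply: (@cvgM R); last exact: cvg_cst.
  by apply: (@cvgB _ R^o); [exact: gc|exact: Pc].
- move=> v; rewrite inE => /predU1P[->|/Ps Pv].
    by rewrite /k ge scale1r subrKC.
  by rewrite /k Pv subrr (scalar_fun0 gs) scale0r addr0.
- move=> v; have [_ F_lin] := lin_subspace [set` e :: s].
  have -> : P v + k v *: (e - P e) = k v *: (-1 *: P e + e) + P v
    by lincomb R E; ring.
  by apply: (F_lin) => //; exact: F_lin.
Qed.

End ContinuousMinorants.

(** * Suprema and infima for a cone order *)

Section OrderingCone.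
Context {R : realType} {Y : tvsType R}.
Variable K : set Y.
Hypotheses (K_closed : closed K).
Hypotheses (K_cone : convex_cone K) (K_int : interior K !=set0).
Implicit Types (x y : Y) (u v w : \bar Y) (M : set (\bar Y)).

(** Small multiples of an interior point of [K] tend to 0, so closedness supplies the origin, which
    a cone need not contain. *)
Lemma closed_cone0 : K 0.
Proof.
have [k /interior_subset Kk] := K_int.
apply: K_closed => U /(nbhs0_absorbing k)[d d0 dU]; exists (d *: k); split.
  exact: K_cone.2.
by apply: dU; rewrite gtr0_norm.
Qed.

Lemma interior_coneD x y : interior K x -> K y -> interior K (x + y).
Proof.
move=> Kx Ky; rewrite /interior addrC.
apply: filterS (nbhsB y Kx) => _ [k Kk <-]; exact: convex_coneD.
Qed.

Lemma interior_coneZ a x : 0 < a -> interior K x -> interior K (a *: x).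
Proof.
move=> a0 Kx; rewrite /interior.
have a0' : a != 0 by rewrite gt_eqF.
by apply: filterS (nbhsZ a0' Kx) => _ [k Kk <-]; exact: K_cone.2.
Qed.

Lemma interior_cone_absorbs x y : interior K x ->
  exists2 d : R, 0 < d & forall l, `|l| <= d -> interior K (x + l *: y).
Proof.
have := @open_interior Y K.
rewrite openE => /[apply] /nbhs_shift /(nbhs0_absorbing y)[d d0 dK].
by exists d.
Qed.

Lemma ltK_EFin x y : ltK K x%:E y%:E <-> interior K (y - x).
Proof.
split=> [[k Kk kE]|Kyx]; first by rewrite -opprB -kE opprK.
by exists (y - x) => //; rewrite opprB.
Qed.

Lemma leK_EFin x y : leK K x%:E y%:E <-> K (y - x).
Proof.
split=> [[k Kk kE]|Kyx]; first by rewrite -opprB -kE opprK.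
by exists (y - x) => //; rewrite opprB.
Qed.

Lemma oppe_lmodK : involutive (@oppe Y).
Proof. by case=> [y||] //=; rewrite opprK. Qed.

Lemma ltKN u v : ltK K (- u)%E (- v)%E <-> ltK K v u.
Proof.
case: u => [x| |]; case: v => [y| |]; try by split.
by split=> /ltK_EFin lt; apply/ltK_EFin; move: lt; rewrite opprK addrC.
Qed.

Lemma WInfP_iff M v : WInf K M v <->
  (forall w, M w -> ~ ltK K w v) /\
  (forall u, ltK K v u -> exists2 w, M w & ltK K w u).
Proof.
split=> [[v' [v'1 v'2] <-]|[v1 v2]].
  split=> [w Mw /ltKN|u].
    by rewrite oppe_lmodK; apply: v'1; exists w.
  rewrite -[u]oppe_lmodK => /ltKN /v'2[_ [w Mw <-]] /ltKN lt.
  by exists w; rewrite ?oppe_lmodK.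
exists (- v)%E; last by rewrite oppe_lmodK.
split=> [_ [w Mw <-] /(ltKN _ _).1|u]; first exact: v1.
rewrite -[u]oppe_lmodK => /(ltKN _ _).1 /v2[w Mw lt].
exists (- w)%E; first by exists w.
exact/ltKN.
Qed.

Lemma oppe_WSup M : oppe @` WSup K M = WInf K (oppe @` M).
Proof.
rewrite /WInf image_comp; congr (_ @` WSup K _).
apply/seteqP; split => [v Mv|_ [v Mv <-]]; last by rewrite /= oppe_lmodK.
by exists v; rewrite //= oppe_lmodK.
Qed.

(* Moving from [y] along an interior direction of [K], the first point that
   is not strictly below the values in [M] is an infimum. *)
Lemma WInf_above M x y : M x%:E -> (forall w, M w -> ~ ltK K w y%:E) ->
  exists2 k, K k & WInf K M (y + k)%:E.
Proof.
move=> Mx My; have [k0 Kk0] := K_int; have Kk := interior_subset Kk0.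
pose I := [set t : R | exists2 w, M w & ltK K w (y + t *: k0)%:E].
have I_up s t : I s -> s <= t -> I t.
  move=> [w Mw lt]; rewrite le_eqVlt => /predU1P[<-|st]; exists w => //.
  case: w lt {Mw} => [w||] //= /ltK_EFin lt; apply/ltK_EFin.
  have -> : y + t *: k0 - w = y + s *: k0 - w + (t - s) *: k0 by lincomb R Y; ring.
  by apply: interior_coneD => //; apply: K_cone.2; rewrite ?subr_gt0.
have I_ge0 t : I t -> 0 <= t.
  move=> It; rewrite leNgt; apply/negP => t0.
  have [w Mw] := I_up _ _ It (ltW t0).
  by rewrite scale0r addr0; exact: My.
have I0 : I !=set0.
  have [d d0 /(_ d)] := interior_cone_absorbs (y - x) Kk0.
  rewrite gtr0_norm// => /(_ (lexx _)) Kd; exists d^-1, x%:E => //.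
  apply/ltK_EFin; have := interior_coneZ (a := d^-1) _ Kd.
  rewrite invr_gt0 scalerDr scalerA mulVf ?gt_eqF// scale1r => /(_ d0).
  by have -> : y + d^-1 *: k0 - x = d^-1 *: k0 + (y - x) by lincomb R Y; ring.
have infI : has_inf I by split => //; exists 0 => t; exact: I_ge0.
have t0 : 0 <= inf I by apply: lb_le_inf => // t; exact: I_ge0.
exists (inf I *: k0).
  move: t0; rewrite le_eqVlt => /predU1P[<-|t0]; last exact: K_cone.2.
  by rewrite scale0r; exact: closed_cone0.
(* Both halves use that [interior K] is open: a strict inequality at height [inf I] would persist at
   [inf I - d], and a point strictly above [y + inf I *: k0] stays above [y + (inf I + d) *: k0] for
   small [d]. *)
apply/WInfP_iff; split.
  move=> [w||] //= Mw.
    move=> /ltK_EFin /(interior_cone_absorbs k0)[d d0 /(_ (- d))].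
    rewrite normrN gtr0_norm// => /(_ (lexx _)) Kd.
    suff /(ge_inf infI.2) : I (inf I - d) by rewrite leNgt ltrBlDr ltrDl d0.
    exists w%:E => //; apply/ltK_EFin.
    by have -> : y + (inf I - d) *: k0 - w = y + inf I *: k0 - w + - d *: k0
      by lincomb R Y; ring.
  by case.
  by move=> _; exact: (My _ Mw).
move=> [u||] // lt; last by exists x%:E.
have {lt} := lt => /ltK_EFin /(interior_cone_absorbs k0)[d d0 /(_ (- d))].
rewrite normrN gtr0_norm// => /(_ (lexx _)) Kd.
have [t It td] := inf_adherent d0 infI.
have [w Mw lt] := I_up _ _ It (ltW td); exists w => //.
case: w lt {Mw} => [w||] //= /ltK_EFin lt; apply/ltK_EFin.
have -> : u - w = (y + (inf I + d) *: k0 - w) +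
    (u - (y + inf I *: k0) + - d *: k0) by lincomb R Y; ring.
by apply: interior_coneD => //; exact: interior_subset.
Qed.

End OrderingCone.

(** * Weak duality, and reduction of strong duality to attained infima *)

Section WeakDuality.
Context {R : realType} {X Y Z : tvsType R}.
Variables (K : set Y) (Phi : X * Z -> \bar Y).
Hypotheses (K_closed : closed K).
Hypotheses (K_cone : convex_cone K) (K_int : interior K !=set0).
Hypotheses (Phi_ninfty : forall p, Phi p <> -oo%E) (Phi_0 : pi_dom Phi 0).
Implicit Types (L : {linear X -> Y}) (T : {linear Z -> Y}).

Lemma oppe_conjugate L T : oppe @` conjugate K Phi L T =
  WInf K [set (Phi p - (L p.1 + T p.2)%R%:E)%E | p in [set: X * Z]].
Proof.
rewrite oppe_WSup image_comp; congr (WInf K (_ @` _)); apply/funext => p /=.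
by case: (Phi p) => [y||] //=; congr EFin; rewrite opprB addrC.
Qed.

Lemma primal_finite_value L :
  exists y, [set (Phi (x, 0%R) - (L x)%:E)%E | x in [set: X]] y%:E.
Proof.
have [[x z] + /= z0] := Phi_0; rewrite z0 /domPhi /=.
case Phi_x: (Phi (x, 0)) (@Phi_ninfty (x, 0)) => [y||] // _ _.
by exists (y - L x), x => //; rewrite Phi_x.
Qed.

Lemma ninfty_ltK (v : \bar Y) : v <> -oo%E -> ltK K -oo%E v.
Proof. by case: v. Qed.

(* Weak duality holds for any set [D] of dual variables, so that only the
   attainment of the finite infima has to be checked. *)
Lemma primal_value_eq_dual_value L (D : set {linear Z -> Y}) :
  (forall y, WInfP K Phi L y%:E ->
     exists2 T, D T & (oppe @` conjugate K Phi L T) y%:E) ->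
  WInfP K Phi L = WMax_value K (\bigcup_(T in D) (oppe @` conjugate K Phi L T)).
Proof.
move=> attained; set M := \bigcup_(T in D) _.
pose P := [set (Phi (x, 0%R) - (L x)%:E)%E | x in [set: X]].
have [p0 Pp0] : exists y, P y%:E := primal_finite_value L.
have P_not_ninfty w : P w -> w <> -oo%E.
  by move=> [x _ <-]; case: (Phi (x, 0)) (@Phi_ninfty (x, 0)).
have weak m w : M m -> P w -> ~ ltK K w m.
  move=> [T _]; rewrite oppe_conjugate => /WInfP_iff[] // m1 _ [x _ <-].
  by apply: m1; exists (x, 0) => //=; rewrite linear0 addr0.
have M_not_pinfty m : M m -> m <> +oo%E.
  by move=> /weak/(_ Pp0) + mE; rewrite mE; apply.
have notP u : ~ (exists2 w, P w & ltK K w u) -> forall w, P w -> ~ ltK K w u.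
  by move=> nP w Pw lt; apply: nP; exists w.
(* If -oo is a primal infimum, it is the only one, and weak duality leaves no other dual value; an
   empty [M] falls under the convention of [WMax_value]. *)
rewrite /WMax_value; have [Pninfty|nPninfty] := pselect (WInfP K Phi L -oo%E).
  have P_below u : ltK K -oo%E u -> exists2 w, P w & ltK K w u.
    by move=> lt; have [_] := (WInfP_iff _ _ _).1 Pninfty; apply.
  have -> : WInfP K Phi L = [set -oo%E].
    apply/seteqP; split => [v /WInfP_iff[v1 _]|_ -> //].
    apply: contrapT => v_ninfty; have [|w Pw] := P_below v; last exact: v1.
    exact: ninfty_ltK.
  case: asboolP => // /eqP/set0P[m0 Mm0].
  have MN m : M m -> m = -oo%E.
    move=> Mm; apply: contrapT => m_ninfty.
    have [|w Pw] := P_below m; last exact: weak.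
    exact: ninfty_ltK.
  apply/seteqP; split=> [_ ->|m [/MN]//]; split; first by rewrite -(MN _ Mm0).
  by split=> [w /MN ->|u]; [case|case: u].
(* Otherwise some level has no primal value strictly below it. Raising it gives a finite infimum,
   and its attainment makes [M] nonempty. *)
have [u1 [u1_gt Pu1]] : exists u, ltK K -oo%E u /\ ~ exists2 w, P w & ltK K w u.
  apply: contrapT => H; apply: nPninfty; apply/WInfP_iff => //; split.
    by move=> w Pw; case: w {Pw} => [w||]; case.
  by move=> u lt; apply: contrapT => nw; apply: H; exists u.
have exists_inf u : ~ (exists2 w, P w & ltK K w u%:E) ->
    exists2 k, K k & WInfP K Phi L (u + k)%:E.
  by move=> /notP; exact: WInf_above Pp0.
have [y1 y1_inf] : exists y, WInfP K Phi L y%:E.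
  case: u1 u1_gt Pu1 => [u||] // _.
    by move=> /exists_inf[k _ ?]; exists (u + k).
  by case; exists p0%:E.
have infM y : WInfP K Phi L y%:E -> M y%:E.
  by move=> /attained[T DT Ty]; exists T.
case: asboolP => [M0|_]; first by have := infM _ y1_inf; rewrite M0.
apply/seteqP; split=> [v v_inf|v [Mv [v1 v2]]].
  have [v1 v2] := (WInfP_iff _ _ _).1 v_inf.
  have Mv : M v.
    case: v v_inf v1 v2 => [v /infM//||//] _ v1 _.
    by have [] := v1 _ Pp0.
  split=> //; split; last by move=> u lt; exists v.
  by move=> m Mm /v2[w Pw]; exact: weak.
apply/WInfP_iff; split; first by move=> w; exact: weak.
(* A finite [u] strictly above [v] with no primal value below it could be raised to an infimum
   [u + k]. This would be a dual value strictly above [v], against the maximality of [v]. *)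
move=> u lt; apply: contrapT => Pu.
case: u lt Pu => [u||]; last by case: v {Mv v1 v2}.
  move=> lt /exists_inf[k Kk /infM Muk]; apply: (v1 _ Muk).
  case: v lt {Mv v1 v2} => [v||] //= /ltK_EFin lt.
  apply/ltK_EFin; rewrite addrAC; exact: interior_coneD.
by move=> _; case; exists p0%:E.
Qed.

End WeakDuality.

(** * Scalar multipliers *)

Section Multipliers.
Context {R : realType} {X Y Z : tvsType R}.
Variables (K : set Y) (Phi : X * Z -> \bar Y).
Hypotheses (K_closed : closed K) (K_cone : convex_cone K).
Hypotheses (Phi_ninfty : forall p, Phi p <> -oo%E) (Phi_convex : K_convex K Phi).

Lemma epiKP x z y : epiK K Phi (x, z, y) <->
  exists2 y0, Phi (x, z) = y0%:E & K (y - y0).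
Proof.
split=> [[k Kk /=]|[y0 Phi_xz Ky]]; last first.
  by exists (y - y0) => //=; rewrite Phi_xz -{1}(subrKC y0 y).
case Phi_xz: (Phi (x, z)) => [y0||] //= [->]; exists y0 => //.
by rewrite addrAC subrr add0r.
Qed.

Lemma domPhiP x z : domPhi Phi (x, z) <-> exists y, Phi (x, z) = y%:E.
Proof.
rewrite /domPhi /=; split=> [|[y ->]//].
by case: (Phi (x, z)) (@Phi_ninfty (x, z)) => [y||] // _ _; exists y.
Qed.

Variables (L : {linear X -> Y}) (L_cont : continuous L).
Variables (y k : Y) (Kk : interior K k) (y_inf : WInfP K Phi L y%:E).

Lemma interior_cone_large v : exists2 t0 : R, 0 < t0 &
  forall t, t0 <= t -> interior K (v + t *: k).
Proof.
have [d d0 dK] := interior_cone_absorbs v Kk; exists d^-1; rewrite ?invr_gt0//.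
move=> t dt; have t0 : 0 < t by rewrite (lt_le_trans _ dt)// invr_gt0.
have -> : v + t *: k = t *: (k + t^-1 *: v).
  by rewrite scalerDr scalerA divff ?gt_eqF// scale1r addrC.
apply: interior_coneZ => //; apply: dK; rewrite gtr0_norm ?invr_gt0//.
by rewrite invf_ple ?posrE.
Qed.

Definition strict_values : set (Z * Y) := [set q | exists x y0,
  Phi (x, q.1) = y0%:E /\ interior K (q.2 + L x - y0)].

Lemma strict_values_convex a z y1 z' y2 : 0 < a < 1 ->
  strict_values (z, y1) -> strict_values (z', y2) ->
  strict_values (a *: z + (1 - a) *: z', a *: y1 + (1 - a) *: y2).
Proof.
move=> /andP[a0 a1] [x [y0 [/= Phi_xz Ky1]]] [x' [y0' [/= Phi_xz' Ky2]]].
have K0 : K 0 by apply: closed_cone0 => //; exists k.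
have /convex_setP/(_ a (x, z, y0) (x', z', y0')) := Phi_convex.
case.
- by rewrite !ltW.
- by apply/epiKP; exists y0; rewrite ?subrr.
- by apply/epiKP; exists y0'; rewrite ?subrr.
move=> l Kl /= e.
have /epiKP[w Phi_w Kw] : epiK K Phi (a *: x + (1 - a) *: x',
  a *: z + (1 - a) *: z', a *: y0 + (1 - a) *: y0') by exists l.
exists (a *: x + (1 - a) *: x'), w; split => //=.
rewrite linearD !linearZ /=.
have -> : a *: y1 + (1 - a) *: y2 + (a *: L x + (1 - a) *: L x') - w =
   a *: (y1 + L x - y0) + ((1 - a) *: (y2 + L x' - y0') +
     (a *: y0 + (1 - a) *: y0' - w)) by lincomb R Y; ring.
apply: (interior_coneD K_cone); first exact: interior_coneZ.
apply: interior_subset; apply: (interior_coneD K_cone) => //.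
by apply: interior_coneZ; rewrite ?subr_gt0.
Qed.

(* The cone generated by [{(z, t) | (z, y + t k) is a strict value}]. *)
Definition value_cone : set (Z * R) := [set q |
  exists2 a, 0 < a & strict_values (a *: q.1, y + (a * q.2) *: k)].

Lemma value_cone_above : above_cone value_cone.
Proof.
split.
- move=> u s v t [a /= a0 su] [b /= b0 sv].
  have ab0 : 0 < a + b by exact: addr_gt0.
  (* With weights [b / (a + b)] and [a / (a + b)] on the scaled points [a *: u] and [b *: v], both
     vectors receive the common factor [a * b / (a + b)]. *)
  have c01 : 0 < b / (a + b) < 1.
    by rewrite divr_gt0//= ltr_pdivrMr// mul1r ltrDr.
  exists (a * b / (a + b)); first by rewrite divr_gt0// mulr_gt0.
  have := strict_values_convex c01 su sv.
  congr (strict_values (_, _)) => /=.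
    by lincomb R Z; field; rewrite gt_eqF.
  by lincomb R Y; field; rewrite gt_eqF.
- move=> l u s l0 [a /= a0 su]; exists (a / l); rewrite ?divr_gt0//=.
  by rewrite scalerA mulrA -(mulrA a) mulVf ?gt_eqF// mulr1.
- move=> t [a a0 /=]; rewrite scaler0 => -[x [y0 [/= Phi_x Ky]]].
  rewrite leNgt; apply/negP => t0.
  have [y1 _] := (WInfP_iff _ _ _).1 y_inf.
  apply: (y1 (y0 - L x)%:E); first by exists x => //; rewrite Phi_x.
  apply/ltK_EFin; have -> : y - (y0 - L x) =
      (y + (a * t) *: k + L x - y0) + (- (a * t)) *: k by lincomb R Y; ring.
  apply: (interior_coneD K_cone) => //; apply: K_cone.2.
    by rewrite -mulrN mulr_gt0// oppr_gt0.
  exact: interior_subset.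
Qed.

Lemma value_cone_dom z t : value_cone (z, t) ->
  exists2 a, 0 < a & pi_dom Phi (a *: z).
Proof.
move=> [a /= a0 [x [y0 [/= Phi_xz _]]]]; exists a => //.
by exists (x, a *: z) => //; rewrite /domPhi/= Phi_xz.
Qed.

Lemma value_cone_Z0 z t : value_cone (z, t) -> Z0 Phi z.
Proof.
move=> /value_cone_dom[a a0 /sub_lin/(subspaceZ a^-1 (lin_subspace _))].
by rewrite scalerA mulVf ?gt_eqF// scale1r.
Qed.

Lemma dom_value_cone a z : 0 < a -> pi_dom Phi (a *: z) ->
  exists t, value_cone (z, t).
Proof.
move=> a0 [[x z'] /= + zE]; rewrite zE => /domPhiP[y0 Phi_xz].
have [t0 t00 tK] := interior_cone_large (y + L x - y0).
exists (a^-1 * t0); exists a => //; exists x, y0; split => //=.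
rewrite mulrA divff ?gt_eqF// mul1r.
have -> : y + t0 *: k + L x - y0 = y + L x - y0 + t0 *: k by lincomb R Y; ring.
exact: tK.
Qed.

(** Passing from [a *: z] to 0 does not increase [Phi (x, _)], so the strict value stays strict at
    the same height over 0, where heights are nonnegative. *)
Lemma value_cone_mono_ge0 z t : value_cone (z, t) ->
  (forall x a, 0 < a -> domPhi Phi (x, a *: z) ->
    leK K (Phi (x, 0)) (Phi (x, a *: z))) -> 0 <= t.
Proof.
move=> [a /= a0 [x [y0 [/= Phi_xz Ky]]]] /(_ x a a0).
rewrite Phi_xz /domPhi/= Phi_xz => /(_ ltac:(by [])).
case Phi_x0: (Phi (x, 0)) (@Phi_ninfty (x, 0)) => [y1||] // _ /leK_EFin Ky1.
have [_ _] := value_cone_above; apply; exists a => //=.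
rewrite scaler0; exists x, y1; split => //=.
have -> : y + (a * t) *: k + L x - y1 =
  y + (a * t) *: k + L x - y0 + (y0 - y1) by lincomb R Y; ring.
exact: interior_coneD.
Qed.

Definition multiplier (h : Z -> R) : Prop :=
  [/\ scalar h, continuous (h : Z -> R^o) &
    forall z t, value_cone (z, t) -> h z <= t].

(** If [Phi (x, z) - L x - h z *: k] were strictly below [y], it would remain so after lowering [y]
    by [d *: k], which puts [(z, h z - d)] in the value cone, below the minorant. The other half of
    the infimum property uses only the values at [z = 0]. Since the conjugate contains the finite
    point [- y], it is not the singleton +oo, whence [LPhi]. *)
Lemma multiplier_dual h : multiplier h -> exists T : {linear Z -> Y},
  [/\ T = (fun z => h z *: k) :> (Z -> Y), LPhi K Phi T &
    (oppe @` conjugate K Phi L T) y%:E].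
Proof.
move=> [hs hc hle].
have [|T TE] := @linear_exists R Z Y (fun z => h z *: k).
  by move=> a u v; rewrite hs scalerDl scalerA.
have Tc : continuous T.
  rewrite TE => z; apply: (@continuous_comp _ _ _ (fun z => (h z : R^o, k))
    (fun q : R^o * Y => q.1 *: q.2)); last exact: scale_continuous.
  by apply: (@cvg_pair _ _ _ _ (nbhs (h z : R^o))); [exact: hc|exact: cvg_cst].
have Ty : (oppe @` conjugate K Phi L T) y%:E.
  rewrite oppe_conjugate; apply/WInfP_iff; split.
    move=> _ [[x z] _ <-] /=.
    case Phi_xz: (Phi (x, z)) (@Phi_ninfty (x, z)) => [y0||];
      [move=> _ lt|by move=> _; case|by move=> /(_ erefl)].
    have /ltK_EFin : ltK K (y0 - (L x + T z))%R%:E y%:E := lt.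
    move=> /(interior_cone_absorbs k)[d d0 /(_ (- d))].
    rewrite normrN gtr0_norm// => /(_ (lexx _)) Kd.
    have /hle : value_cone (z, h z - d).
      exists 1 => //; rewrite scale1r mul1r; exists x, y0; split => //=.
      have -> : y + (h z - d) *: k + L x - y0 =
        y - (y0 - (L x + h z *: k)) + - d *: k by lincomb R Y; ring.
      by move: Kd; rewrite TE.
    by rewrite lerBrDr gerDl leNgt d0.
  have [_ y_above] := (WInfP_iff _ _ _).1 y_inf.
  move=> u /y_above[_ [x _ <-] lt].
  exists (Phi (x, 0%R) - (L x)%:E)%E; last exact: lt.
  by exists (x, 0) => //=; rewrite linear0 addr0.
exists T; split => //; split => //; exists L => // conj_pinfty.
by move: Ty; rewrite conj_pinfty => -[_ ->].
Qed.

(** The height [t] is the same along the whole ray through [- z], and a linear functional bounded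
    above on a ray cannot be positive in its direction. *)
Lemma multiplier_nonneg h z : multiplier h ->
  (exists t, forall l, 0 < l -> value_cone (l *: (- z), t)) -> 0 <= h z.
Proof.
move=> [hs _ hle] [t tle]; rewrite leNgt; apply/negP => hz.
have /tle/hle : 0 < (`|t| + 1) / (- h z).
  by rewrite divr_gt0 ?oppr_gt0// ltr_wpDl.
rewrite (scalar_funZ hs) (scalar_funN hs) mulfVK ?oppr_eq0 ?lt_eqF//.
by rewrite leNgt (le_lt_trans (ler_norm t))// ltrDl.
Qed.

(** Only the height [y1] is uniform: the point [x] hidden in [strict_values] may depend on [z]. The
    number [t0] is chosen so that [y + t0 *: k] lies above [y1]. *)
Lemma bounded_multiplier y1 V : nbhs 0 V ->
  (forall z, V z -> Z0 Phi z -> strict_values (z, y1)) ->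
  exists h, multiplier h.
Proof.
move=> V0 Vy1.
have [t0 _ tK] := interior_cone_large (y - y1).
have [|||||h [hs hc hle]] := @continuous_minorant R Z value_cone (Z0 Phi) V t0.
- exact: value_cone_above.
- exact: lin_subspace.
- exact: value_cone_Z0.
- exact: V0.
- move=> z Vz /(Vy1 _ Vz)[x [y0 [/= Phi_xz Ky1]]].
  exists 1 => //; rewrite /= scale1r mul1r; exists x, y0; split => //=.
  have -> : y + t0 *: k + L x - y0 = (y1 + L x - y0) + (y - y1 + t0 *: k)
    by lincomb R Y; ring.
  by apply: (interior_coneD K_cone) => //; apply: interior_subset; exact: tK.
by exists h.
Qed.

Lemma icr_dom z : pi_dom Phi 0 -> icr (pi_dom Phi) 0 -> Z0 Phi z ->
  exists2 d, 0 < d & forall l, 0 <= l <= d -> pi_dom Phi (l *: z).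
Proof.
move=> dom0 icr0 Z0z.
have /icr0[d d0 dP] : aff (pi_dom Phi) z.
  by apply: lin_sub_aff => // A [_]; apply.
by exists d => // l /dP; rewrite add0r.
Qed.

(** Pulled back along [P], the value cone lies over all of [Z], because every point of [Z0] has a
    positive multiple in the domain. The minorant composed with [P] is continuous, and still a
    minorant because [P] is the identity on [Z0]. *)
Lemma finite_dim_multiplier : hausdorff_space Z -> pi_dom Phi 0 ->
  finite_dim (Z0 Phi) -> icr (pi_dom Phi) 0 -> exists h, multiplier h.
Proof.
move=> hZ dom0 [s Z0E] icr0; have [P [Pl Pc Ps PZ0]] := finite_dim_projector s hZ.
have PE z : Z0 Phi z -> P z = z.
  rewrite Z0E; apply: (@smallest_sub _ linear_subspace _ [set z | P z = z]).
    split=> [|a u v /= Pu Pv]; last by rewrite Pl Pu Pv.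
    by have := Pl (-1) 0 0; rewrite scaler0 addr0 scaleN1r addNr.
  by move=> v /Ps.
have [G_D G_Z G_0] := value_cone_above.
have P0 : P 0 = 0 by apply: PE; exact: (lin_subspace _).1.
have [||h hs hle] := @hahn_banach_above_cone R Z
    [set q | value_cone (P q.1, q.2)].
- split=> [u r v t /= Pu Pv|a u r a0 /= Pu|t /=]; last by rewrite P0; exact: G_0.
    by have := Pl 1 u v; rewrite !scale1r => ->; exact: G_D.
  by have := Pl a u 0; rewrite !P0 !addr0 => ->; exact: G_Z.
- move=> v; have /(icr_dom dom0 icr0)[d d0 dP] : Z0 Phi (P v).
    by rewrite Z0E; exact: PZ0.
  have [||t vt] := @dom_value_cone d (P v) => //; last by exists t.
  by apply: dP; rewrite lexx ltW.
exists (h \o P); split; last 1 first.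
- move=> z t zt; have Pz := PE _ (value_cone_Z0 zt).
  by rewrite /= Pz; apply: hle; rewrite /= Pz.
- by move=> a u v /=; rewrite Pl hs.
- exact: Pc.
Qed.

(* The dual cone of [S] is reached by subtracting [S] from the first
   coordinate of the value cone, which leaves its fibre over [0] in place. *)
Lemma interior_multiplier (S : set Z) : convex_cone S ->
  [set z - s | z in pi_dom Phi & s in interior S] 0 ->
  (forall x z, domPhi Phi (x, z) -> S z ->
    leK K (Phi (x, 0)) (Phi (x, z))) ->
  exists2 h, multiplier h & forall s, S s -> 0 <= h s.
Proof.
move=> S_cone [z1 dom_z1 [s1 Ss1 /eqP]]; rewrite subr_eq0 => /eqP z1s1.
rewrite -{s1}z1s1 in Ss1 => Phi_mono.
have [G_D G_Z G_0] := value_cone_above.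
have [||t1 Gt1] := @dom_value_cone 1 z1 => //; first by rewrite scale1r.
pose G := [set q : Z * R | exists2 s, S s & value_cone (q.1 + s, q.2)].
have nS := nbhs_shift Ss1.
have coneG : above_cone G.
  split.
  - move=> u r v t [s /= Ss us] [s' /= Ss' vs']; exists (s + s').
      exact: convex_coneD.
    by rewrite /= addrACA; exact: G_D.
  - move=> a u r a0 [s /= Ss us]; exists (a *: s); first exact: S_cone.2.
    by rewrite /= -scalerDr; exact: G_Z.
  - move=> t [s /= Ss]; rewrite add0r => /value_cone_mono_ge0; apply.
    by move=> x a a0 /Phi_mono; apply; exact: S_cone.2.
have [|h hs hle] := hahn_banach_above_cone coneG.
  (* For small [d] the point [z1 - d *: v] is still in [S]; adding its multiple by [d^-1] to [v]
     gives [d^-1 *: z1], over which the value cone has the height [d^-1 * t1]. *)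
  move=> v; have [d d0 dS] := nbhs0_absorbing (- v) nS.
  exists (d^-1 * t1), (d^-1 *: (z1 + d *: (- v))) => /=.
    apply: S_cone.2; rewrite ?invr_gt0//.
    by apply: dS; rewrite gtr0_norm.
  have -> : v + d^-1 *: (z1 + d *: (- v)) = d^-1 *: z1.
    by lincomb R Z; field; rewrite gt_eqF.
  by apply: G_Z; rewrite ?invr_gt0.
have hS s : S s -> 0 <= h s.
  move=> Ss; rewrite leNgt; apply/negP => hs0.
  have l0 : 0 < (`|t1 - h z1| + 1) / (- h s).
    by rewrite divr_gt0 ?oppr_gt0// ltr_wpDl.
  have /hle : G (z1 - ((`|t1 - h z1| + 1) / (- h s)) *: s, t1).
    by eexists; [exact: (S_cone.2 _ _ l0 Ss)|rewrite /= subrK].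
  rewrite (scalar_funB hs) (scalar_funZ hs) -lerBrDl.
  rewrite -mulrN mulfVK ?oppr_eq0 ?lt_eqF//.
  by rewrite leNgt (le_lt_trans (ler_norm _))// ltrDl.
(* As [S] need not contain 0, [G] need not contain the value cone; a small multiple of [z1] is
   subtracted instead, at a cost of at most [e]. *)
have hG z t : value_cone (z, t) -> h z <= t.
  move=> zt; have Sz1 := interior_subset Ss1.
  apply/ler_addgt0Pl => e e0.
  have hz1 := hS _ Sz1.
  have h1 : 0 < h z1 + 1 by rewrite ltr_wpDl.
  have /hle : G (z - (e / (h z1 + 1)) *: z1, t).
    exists ((e / (h z1 + 1)) *: z1); last by rewrite /= subrK.
    by apply: S_cone.2 => //; rewrite divr_gt0.
  rewrite (scalar_funB hs) (scalar_funZ hs) lerBlDr => /le_trans; apply.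
  rewrite addrC lerD2r -mulrA ler_piMr ?(ltW e0)//.
  by rewrite mulrC ler_pdivrMr// mul1r lerDl.
exists h => //; split => //.
(* Nonnegativity on [S] already gives continuity: [z1 + v] in [S] means [h (- v) <= h z1], a bound
   on a neighbourhood of 0. *)
apply: (bounded_above_scalar_continuous (M := h z1) hs (nbhs0N nS)).
move=> _ [v Sv <-]; rewrite (scalar_funN hs) -subr_ge0 opprK.
by rewrite -(scalar_funD hs); exact: hS.
Qed.

Lemma zero_multiplier :
  (forall x z, domPhi Phi (x, z) -> leK K (Phi (x, 0)) (Phi (x, z))) ->
  multiplier (fun=> 0).
Proof.
move=> Phi_mono; split; first by move=> a u v; rewrite mulr0 addr0.
  by move=> z; exact: cvg_cst.
by move=> z t /value_cone_mono_ge0; apply => x a _; exact: Phi_mono.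
Qed.

End Multipliers.

(** * Open ranges of closed convex relations *)

Section OpenRange.
Context {R : realType} {E Z : tvsType R}.

Lemma nbhs0_half (F : tvsType R) (U : set F) : nbhs 0 U -> exists V : set F,
  [/\ nbhs 0 V, convex_set V, forall v, V v -> V (- v) &
     forall u v, V u -> V v -> U (u + v)].
Proof.
move=> U0; have two0 : 2 != 0 :> R by rewrite pnatr_eq0.
have [V [V0 VU cV VN]] := nbhs0_convex_sym (nbhs0_scale two0 U0).
exists V; split => // u v Vu Vv.
have -> : u + v = 2 *: (2^-1 *: u + (1 - 2^-1) *: v) by lincomb R F; field.
apply: VU; move/convex_setP : cV; apply => //.
by rewrite invr_ge0 ler0n invf_le1// ler1n.
Qed.

Lemma closure_convex (F : tvsType R) (A : set F) :
  convex_set A -> convex_set (closure A : set F).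
Proof.
move=> /convex_setP cA; apply/convex_setP => a x y a01 Ax Ay U.
move=> /nbhs_shift U0; have [V [V0 VU /convex_setP cV _]] := nbhs0_convex_sym U0.
have near_A z : closure A z -> exists2 v, V v & A (z + v).
  move=> /(_ [set w | V (w - z)])[|w [Aw Vw]].
    by apply: nbhs_unshift; apply: filterS V0 => v /=; rewrite addrAC subrr add0r.
  by exists (w - z) => //; rewrite subrKC.
have [u Vu Axu] := near_A _ Ax; have [v Vv Ayv] := near_A _ Ay.
exists (a *: (x + u) + (1 - a) *: (y + v)); split; first exact: cA.
have -> : a *: (x + u) + (1 - a) *: (y + v) =
  a *: x + (1 - a) *: y + (a *: u + (1 - a) *: v) by lincomb R F; ring.
by apply: VU; exact: cV.
Qed.

Definition sequentially_complete := forall u : nat -> E,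
  cauchy_net (fun m n => (m <= n)%N) u ->
  exists l, net_cvg (fun m n => (m <= n)%N) u l.

(* Robinson-Ursescu: barreledness makes the closures of the images of
   neighbourhoods into neighbourhoods, and a point [z] of such a closure is
   reached exactly, up to the factor [1/2], by successive approximation:
   [z = z_0 + w_1 / 2] and [w_n = z_n + w_(n+1) / 2] where [z_n] is the image of
   [u_n], the limit of the preimages being [\sum_n u_n / 2^(n+1)]. *)
Lemma open_range (H : set (E * Z)) (F : set Z) (e0 : E) (U : set E) :
  first_countable E -> sequentially_complete ->
  closed H -> convex_set H -> H (e0, 0) ->
  linear_subspace F -> barreled F -> (forall e z, H (e, z) -> F z) ->
  (forall z, F z -> exists2 d : R, 0 < d & exists e, H (e, d *: z)) ->
  nbhs e0 U ->
  exists2 N : set Z, nbhs 0 N &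
    forall z, N z -> F z -> exists2 e, U e & H (e, z).
Proof.
move=> fcE scE clH /convex_setP cH H0 Flin barF HF coreF nU.
have FZ a v : F v -> F (a *: v) by exact: subspaceZ.
have half01 : 0 <= (2^-1 : R) <= 1 by apply/andP; split; lra.
pose H' u z := H (e0 + u, z).
have H'0 : H' 0 0 by rewrite /H' addr0.
have cH' a u v z w : 0 <= a <= 1 -> H' u z -> H' v w ->
    H' (a *: u + (1 - a) *: v) (a *: z + (1 - a) *: w).
  move=> a01 Hu Hv; have := cH _ _ _ a01 Hu Hv; rewrite /H'.
  congr (H (_, _)); rewrite /=; lincomb R E; ring.
have H'Z a u z : 0 <= a <= 1 -> H' u z -> H' (a *: u) (a *: z).
  by move=> a01 Hu; have := cH' _ _ _ _ _ a01 Hu H'0; rewrite !scaler0 !addr0.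
have [V [V0 cV VN VU]] := nbhs0_half (nbhs_shift nU).
have [N0 nN0 N0_basis] := fcE 0.
have /choice[C CP] : forall n, exists D : set E,
    [/\ nbhs 0 D, D `<=` V `&` N0 n, convex_set D & forall x, D x -> D (- x)].
  by move=> n; apply: nbhs0_convex_sym; apply: filterI.
(* The basis [N0] need not be decreasing; intersecting the first sets makes it so. *)
pose W n := [set x | forall i, (i <= n)%N -> C i x].
have W0 n : nbhs 0 (W n).
  elim: n => [|n IH].
    by have [C0 _ _ _] := CP 0; apply: filterS C0 => x Cx [].
  have [Cn _ _ _] := CP n.+1; apply: filterS (filterI IH Cn) => x [Wx Cx] i.
  by rewrite leq_eqVlt => /predU1P[->//|]; rewrite ltnS; exact: Wx.
have WS n : W n.+1 `<=` W n by move=> x Wx i /leqW; exact: Wx.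
have cW n a x y : 0 <= a <= 1 -> W n x -> W n y -> W n (a *: x + (1 - a) *: y).
  move=> a01 Wx Wy i le_in; have [_ _ /convex_setP cC _] := CP i.
  by apply: cC => //; [exact: Wx|exact: Wy].
have W00 n : W n 0 by exact: nbhs_singleton.
have WZ n a x : 0 <= a <= 1 -> W n x -> W n (a *: x).
  by move=> a01 Wx; have := cW n a x 0 a01 Wx (W00 n); rewrite scaler0 addr0.
have WV n : W n `<=` V.
  by move=> x /(_ n (leqnn n)); have [_ CV _ _] := CP n => /CV[].
have WN0 n : W n `<=` N0 n.
  by move=> x /(_ n (leqnn n)); have [_ CV _ _] := CP n => /CV[].
pose A n := [set z | exists2 u, W n u & H' u z].
pose B n := closure (A n) `&` F.
have cA n : convex_set (A n : set Z).
  apply/convex_setP => a z w a01 [u Wu Hu] [v Wv Hv].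
  by exists (a *: u + (1 - a) *: v); [exact: cW|exact: cH'].
have small_A n z : F z -> exists2 d, 0 < d & forall l, 0 <= l <= d -> A n (l *: z).
  move=> /coreF[d d0 [e He]].
  have [t t0 tW] := nbhs0_absorbing (e - e0) (W0 n).
  pose t' := Num.min t 1; have t'0 : 0 < t' by rewrite lt_min t0 ltr01.
  exists (t' * d); first exact: mulr_gt0.
  move=> l /andP[l0 ld]; exists ((l / d) *: (e - e0)).
    apply: tW; rewrite ger0_norm ?divr_ge0 ?(ltW d0)//.
    by rewrite ler_pdivrMr// (le_trans ld)// ler_pM2r// ge_min lexx.
  have -> : l *: z = (l / d) *: (d *: z).
    by rewrite scalerA -mulrA mulVf ?gt_eqF// mulr1.
  apply: H'Z; last by rewrite /H' subrKC.
  rewrite divr_ge0 ?(ltW d0)//= ler_pdivrMr// (le_trans ld)// ler_pM2r//.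
  by rewrite ge_min lexx orbT.
have /choice[J JP] : forall n, exists J : set Z, nbhs 0 J /\ J `&` F `<=` B n.
  move=> n; have [||||J J0 JB] := barF (B n); last by exists J.
  - by move=> z [].
  - move=> z Fz; have [d d0 dA] := small_A n z Fz.
    (* [small_A] is one-sided while [absorbing_in] is two-sided, so negative multiples go through
       [- z]. *)
    have [d' d'0 dA'] := small_A n _ (FZ (-1) _ Fz).
    exists (Num.min d d'); first by rewrite lt_min d0.
    move=> l; rewrite le_min => /andP[ld ld']; split; last exact: FZ.
    apply: subset_closure; have [l0|l0] := leP 0 l.
      by apply: dA; rewrite l0/= (le_trans (ler_norm _)).
    have -> : l *: z = (- l) *: (-1 *: z) by lincomb R Z; ring.
    apply: dA'; rewrite oppr_ge0 (ltW l0)/= -(ltr0_norm l0)//.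
  - apply/convex_setP => a z w a01 [Az Fz] [Aw Fw]; split.
      by move/convex_setP: (closure_convex (cA n)); exact.
    by apply: Flin.2 => //; exact: FZ.
  - by exists (closure (A n)) => //; exact: closed_closure.
(* The implication stands under the existential so that [choice] yields a total function, which the
   recursion for [w] can iterate. *)
have step n w : exists p : E * Z, B n w ->
    [/\ W n p.1, H' p.1 p.2 & B n.+1 (2 *: (w - p.2))].
  have [Bw|] := pselect (B n w); last by exists (0, 0).
  have [Jn JB] := JP n.+1; have [clAw Fw] := Bw.
  have two0 : - 2 != 0 :> R by rewrite oppr_eq0 pnatr_eq0.
  have := clAw [set z | J n.+1 (- 2 *: (z - w))]; case.
    apply: nbhs_unshift; apply: filterS (nbhs0_scale two0 Jn) => v /=.
    by rewrite addrAC subrr add0r.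
  move=> z [[u Wu Huz] Jz]; exists (u, z) => _; split => //=; apply: JB.
  have -> : 2 *: (w - z) = - 2 *: (z - w) by lincomb R Z; ring.
  split => //; apply: (FZ); rewrite -[z]scale1r; apply: Flin.2.
    exact: HF Huz.
  by rewrite -scaleN1r; exact: FZ.
have /choice[f fP] : forall q : nat * Z, exists p : E * Z, B q.1 q.2 ->
    [/\ W q.1 p.1, H' p.1 p.2 & B q.1.+1 (2 *: (q.2 - p.2))].
  by move=> [n w]; exact: step.
have [J0 J0B] := JP 0%N.
have two0 : 2 != 0 :> R by rewrite pnatr_eq0.
exists [set z | J 0%N (2 *: z)]; first exact: nbhs0_scale.
move=> z0 /= Jz0 Fz0.
pose w := fix w n := if n is m.+1 then 2 *: (w m - (f (m, w m)).2) else 2 *: z0.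
pose u n := (f (n, w n)).1; pose z n := (f (n, w n)).2.
have wS n : w n.+1 = 2 *: (w n - z n) by [].
have wB n : B n (w n).
  elim: n => [|n IH]; first by apply: J0B; split => //; exact: FZ.
  by have [] := fP (n, w n) IH.
have uW n : W n (u n) by have [] := fP (n, w n) (wB n).
have uH n : H' (u n) (z n) by have [] := fP (n, w n) (wB n).
pose c n : R := 2^-1 ^+ n.
have cS n : c n.+1 = 2^-1 * c n by rewrite /c exprS.
have c01 n : 0 <= c n <= 1.
  by rewrite exprn_ge0 ?exprn_ile1// ?invr_ge0 ?ler0n ?invf_le1 ?ler1n.
pose s := fix s n := if n is m.+1 then s m + c m.+1 *: u m else 0.
pose zs := fix zs n := if n is m.+1 then zs m + c m.+1 *: z m else 0.
have sS n : s n.+1 = s n + c n.+1 *: u n by [].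
have zsS n : zs n.+1 = zs n + c n.+1 *: z n by [].
have zsw n : zs n + c n.+1 *: w n = z0.
  elim: n => [|n IH].
    by rewrite /= add0r /c expr1 scalerA mulVf// scale1r.
  by rewrite -IH zsS wS !cS; lincomb R Z; field.
(* The weights [c 1], ..., [c n] leave exactly the mass [c n], so a partial sum completed by any
   point of [H'] with this weight is a convex combination. *)
have partial n v y : H' v y -> H' (s n + c n *: v) (zs n + c n *: y).
  elim: n v y => [|n IH] v y Hv; first by rewrite /c expr0 !scale1r !add0r.
  have := IH _ _ (cH' _ _ _ _ _ half01 (uH n) Hv).
  congr (H' _ _); first by rewrite sS cS; lincomb R E; field.
  by rewrite zsS cS; lincomb R Z; field.
(* By convexity a tail starting at [n] lies in [c n] times [W n]; this makes the partial sums Cauchy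
   and, for [n = 0], keeps them in [V]. *)
have tail n m : exists2 x, W n x & s (n + m)%N = s n + c n *: x.
  elim: m n => [|m IH] n; first by exists 0; rewrite // addn0 scaler0 addr0.
  have [x Wx sE] := IH n.+1; exists (2^-1 *: u n + (1 - 2^-1) *: x).
    by apply: cW => //; exact: WS.
  by rewrite addnS -addSn sE sS cS; lincomb R E; field.
have [l sl] : exists l, net_cvg (fun m n => (m <= n)%N) s l.
  apply: scE => Q /nbhs0_half[Q' [Q'0 _ Q'N QQ]].
  have [n0 n0Q] := N0_basis _ Q'0; exists n0 => i j /subnKC <- /subnKC <-.
  have [x Wx ->] := tail n0 (i - n0)%N; have [y Wy ->] := tail n0 (j - n0)%N.
  have -> : s n0 + c n0 *: x - (s n0 + c n0 *: y) = c n0 *: x - c n0 *: y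
    by lincomb R E; ring.
  by apply: QQ; [|apply: Q'N]; apply: n0Q; apply: WN0; exact: WZ.
exists (e0 + l).
  have [n0 n0V] := sl [set x | V (l - x)] ltac:(
    by apply: nbhs_unshift; apply: filterS V0 => v /VN /=;
       rewrite opprD addrA subrr add0r).
  have [x Wx sE] := tail 0%N n0; have := n0V _ (leqnn n0).
  rewrite /= -[n0]add0n sE add0r /c expr0 scale1r => Vlx.
  by have := VU _ _ (WV _ _ Wx) Vlx; rewrite /= subrKC.
apply: clH => Q [[Q1 Q2] /= [Q1l Q2z] QQ].
have [P [P0 _ _ PQ]] := nbhs0_half (nbhs_shift Q1l).
have [D [D0 DQ cD DN]] := nbhs0_convex_sym (nbhs_shift Q2z).
have [n0 n0P] := N0_basis _ P0.
have [n1 n1P] := sl [set x | P (x - l)] ltac:(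
  by apply: nbhs_unshift; apply: filterS P0 => v /=; rewrite addrAC subrr add0r).
pose n := maxn n0 n1.
(* The remainder [w n] is only in the closure of [A n]. A nearby [y] with a preimage [v] in [W n]
   takes its place and completes the partial sum to a point of [H] close to [(e0 + l, z0)]. *)
have [clAw _] := wB n.
have := clAw [set y | D (y - w n)]; case.
  by apply: nbhs_unshift; apply: filterS D0 => v /=; rewrite addrAC subrr add0r.
move=> y [[v Wv Hv] /= Dy].
have := partial n _ _ (H'Z _ _ _ half01 Hv).
rewrite !scalerA [c n * _]mulrC -cS => Hn.
exists (e0 + (s n + c n.+1 *: v), zs n + c n.+1 *: y); split => //.
apply: QQ; split => /=.
  have -> : e0 + (s n + c n.+1 *: v) = e0 + l + ((s n - l) + c n.+1 *: v)
    by lincomb R E; ring.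
  apply: PQ; first by apply: n1P; exact: leq_maxr.
  apply: n0P; apply: WN0; apply: WZ => // i le_i.
  by apply: Wv; rewrite (leq_trans le_i)// leq_maxl.
have -> : zs n + c n.+1 *: y = z0 + c n.+1 *: (y - w n).
  by rewrite -(zsw n); lincomb R Z; ring.
apply: DQ; apply: convex_scale => //; exact: nbhs_singleton.
Qed.

End OpenRange.

(** * Strong duality *)

Section ProductSpaces.
Context {R : realType} {X Y : tvsType R}.

Lemma prod_first_countable :
  first_countable X -> first_countable Y -> first_countable (X * Y)%type.
Proof.
move=> fcX fcY [x y]; have [A Anbhs Abasis] := fcX x; have [B Bnbhs Bbasis] := fcY y.
(* Numbers that code no pair of indices are given the whole space. *)
pose N n := if unpickle n is Some (i, j) then A i `*` B j else [set: X * Y].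
exists N => [n|U [[U1 U2] /= [/Abasis[i Ai] /Bbasis[j Bj]] UU]].
  rewrite /N; case: unpickle => [[i j]|]; last exact: filterT.
  by exists (A i, B j) => //; split; [exact: Anbhs|exact: Bnbhs].
exists (pickle (i, j)); rewrite /N pickleK => -[u v] [/= Au Bv].
by apply: UU; split; [exact: Ai|exact: Bj].
Qed.

Lemma prod_sequentially_complete :
  net_complete X -> net_complete Y -> @sequentially_complete R (X * Y)%type.
Proof.
move=> cX cY u u_cauchy.
have dir : directed (fun m n : nat => (m <= n)%N).
  split=> //; [exact: (inhabits 0%N)|by move=> i j k; exact: leq_trans|].
  by move=> i j; exists (maxn i j); rewrite leq_maxl leq_maxr.
have [|x ux] := cX nat _ (fun n => (u n).1) dir.
  move=> U U0; have [|n nU] := u_cauchy (U `*` setT).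
    by exists (U, setT) => //; split => //; exact: filterT.
  by exists n => i j ni nj; have [] := nU _ _ ni nj.
have [|y uy] := cY nat _ (fun n => (u n).2) dir.
  move=> U U0; have [|n nU] := u_cauchy (setT `*` U).
    by exists (setT, U) => //; split => //; exact: filterT.
  by exists n => i j ni nj; have [] := nU _ _ ni nj.
exists (x, y) => Q [[Q1 Q2] /= [/ux[n nQ1] /uy[m mQ2]] QQ].
exists (maxn n m) => i; rewrite geq_max => /andP[ni mi].
by apply: QQ; split; [exact: nQ1|exact: mQ2].
Qed.

End ProductSpaces.

(** * From the regularity conditions to multipliers and strong duality *)

Section StrongDuality.
Context {R : realType} {X Y Z : tvsType R}.
Variables (K : set Y) (S : set Z) (Phi : X * Z -> \bar Y).
Hypotheses (Z_hausdorff : hausdorff_space Z).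
Hypotheses (K_closed : closed K) (K_cone : convex_cone K).
Hypotheses (K_int : interior K !=set0) (S_cone : convex_cone S).
Hypotheses (Phi_ninfty : forall p, Phi p <> -oo%E) (Phi_convex : K_convex K Phi).
Hypotheses (Phi_0 : pi_dom Phi 0).

Section FixedInfimum.
Variables (L : {linear X -> Y}) (L_cont : continuous L).
Variables (y k : Y) (Kk : interior K k) (y_inf : WInfP K Phi L y%:E).

Local Notation multiplier := (multiplier K Phi L y k).

Lemma cond1_multiplier : cond1 K Phi -> exists h, multiplier h.
Proof.
move=> [x [y1 [V V0 Vy1]]].
(* Subtracting [L x] turns the bound on [Phi (x, z)] into one on the primal values, and adding [k]
   makes it strict. *)
apply: (bounded_multiplier K_closed K_cone Phi_convex Kk y_inf
  (y1 := y1 - L x + k) V0).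
move=> z Vz Z0z; have := Vy1 _ (conj Vz Z0z).
case Phi_xz: (Phi (x, z)) (@Phi_ninfty (x, z)) => [w||];
  [move=> _ /leK_EFin Kw|by []|by move=> /(_ erefl)].
exists x, w; split => //=.
have -> : y1 - L x + k + L x - w = k + (y1 - w) by lincomb R Y; ring.
exact: interior_coneD.
Qed.

Lemma cond2_multiplier : cond2 Phi -> exists h, multiplier h.
Proof.
move=> [x [y1 Phi_x0 Phi_cont]]; apply: cond1_multiplier.
have [|N N0 NV] := Phi_cont [set v | K (y1 + k - v)].
  apply: nbhs_unshift; have := nbhs0N (nbhs_shift Kk).
  apply: filterS => _ [v Kv <-] /=.
  by have -> : y1 + k - (y1 - v) = k + v by lincomb R Y; ring.
exists x, (y1 + k), N => // z /NV[v Kv <-]; exact/leK_EFin.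
Qed.

Lemma ri_icr : ri (pi_dom Phi) 0 -> icr (pi_dom Phi) 0.
Proof.
move=> [aff0 [N N0 Ndom]] z aff_z.
have [d d0 dN] := nbhs0_absorbing z N0; exists d => // l /andP[l0 ld].
rewrite add0r; apply: Ndom; split; first by apply: dN; rewrite ger0_norm.
move=> A [affA sA].
have := affA l z 0 (aff_z A (conj affA sA)) (aff0 A (conj affA sA)).
by rewrite scaler0 addr0.
Qed.

Lemma cond3_multiplier : cond3 Phi -> exists h, multiplier h.
Proof.
move=> [Z0_fin /ri_icr icr0]; exact: finite_dim_multiplier.
Qed.

(** The epigraph is read as a relation between [(x, v)] and [z], and [open_range] reaches every [z]
    of [Z0] near 0 from a pair close to [(x0, y0)]. The summand [k] of [y1] is the slack that makes
    [U] a neighbourhood of [(x0, y0)], using the continuity of [L]. *)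
Lemma cond4_multiplier : cond4 K Phi -> exists h, multiplier h.
Proof.
move=> [[cX cY] [fcX fcY] barZ0 epi_closed icr0].
have K0 : K 0 by exact: closed_cone0.
have [[x0 z0] + /= z00] := Phi_0; rewrite z00 => /domPhiP[//|y0 Phi_x0].
pose H := [set q : X * Y * Z | epiK K Phi (q.1.1, q.2, q.1.2)].
pose y1 := y0 - L x0 + k.
pose U := [set e : X * Y | interior K (y1 + L e.1 - e.2)].
have [||||||||||N N0 NU] := @open_range R (X * Y)%type Z H (Z0 Phi) (x0, y0) U.
- exact: prod_first_countable.
- exact: prod_sequentially_complete.
- move=> [[x v] z] clH; apply: epi_closed.
  move=> Q [[Q12 Q3] /= [[[Q1 Q2] /= [Q1x Q2z] Q12s] Q3v] QQ].
  have [|[[x' v'] z'] [Hq [/= [Q1x' Q3v'] Q2z']]] := clH ((Q1 `*` Q3) `*` Q2).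
    by exists (Q1 `*` Q3, Q2) => //; split => //; exists (Q1, Q3).
  by exists (x', z', v'); split => //; apply: QQ; split => //; exact: Q12s.
- move/convex_setP: Phi_convex => c_epi; apply/convex_setP.
  move=> a [[x v] z] [[x' v'] z'] a01 /= Hq Hq'; exact: (c_epi _ _ _ a01 Hq Hq').
- by apply/epiKP; exists y0; rewrite // subrr.
- exact: lin_subspace.
- exact: barZ0.
- move=> [x v] z /epiKP[w Phi_xz _]; apply: sub_lin; exists (x, z) => //.
  by rewrite /domPhi/= Phi_xz.
- move=> z /(icr_dom Phi_0 icr0)[d d0 /(_ d)]; rewrite lexx ltW// => /(_ isT).
  move=> [[x z'] /= + z'E]; rewrite z'E => /domPhiP[//|w Phi_xz].
  by exists d => //; exists (x, w); apply/epiKP; exists w; rewrite // subrr.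
- have nKk : nbhs k (interior K).
    by apply: open_nbhs_nbhs; split => //; exact: open_interior.
  have [V [V0 _ VN VV]] := nbhs0_half (nbhs_shift nKk).
  exists ([set x | V (L x - L x0)], [set v | V (y0 - v)]) => /=; last first.
    move=> [x v] [/= Vx Vv]; rewrite /U/=.
    have -> : y1 + L x - v = k + ((L x - L x0) + (y0 - v)).
      by rewrite /y1; lincomb R Y; ring.
    exact: VV.
  split; last first.
    apply: nbhs_unshift; apply: filterS V0 => v /VN /=.
    by rewrite opprD addrA subrr add0r.
  have nV : nbhs (L x0) [set v | V (v - L x0)].
    by apply: nbhs_unshift; apply: filterS V0 => v /=; rewrite addrAC subrr add0r.
  exact: L_cont nV.
apply: (bounded_multiplier K_closed K_cone Phi_convex Kk y_inf (y1 := y1) N0).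
move=> z Nz Z0z; have [[x v] Uxv /epiKP[w Phi_xz Kw]] := NU _ Nz Z0z.
exists x, w; split => //=.
have -> : y1 + L x - w = y1 + L x - v + (v - w) by lincomb R Y; ring.
exact: interior_coneD.
Qed.

Lemma regular_multiplier :
  cond1 K Phi \/ cond2 Phi \/ cond3 Phi \/ cond4 K Phi \/ cond5 K Phi ->
  exists h, multiplier h.
Proof.
move=> [|[|[|[|[Phi_mono _]]]]].
- exact: cond1_multiplier.
- exact: cond2_multiplier.
- exact: cond3_multiplier.
- exact: cond4_multiplier.
- exists (fun=> 0); exact: zero_multiplier.
Qed.

(** The single value [Phi (x, 0)] bounds [Phi (x, _)] on all of [- S], so one height serves along
    each ray, as [multiplier_nonneg] requires. *)
Lemma slater_multiplier_nonneg h : multiplier h ->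
  (exists2 x, domPhi Phi (x, 0) &
    forall z, S (- z) -> leK K (Phi (x, z)) (Phi (x, 0))) ->
  forall s, S s -> 0 <= h s.
Proof.
move=> hm [x /domPhiP[//|p Phi_x0] Phi_mono] s Ss; apply: (multiplier_nonneg hm).
have [t _ tK] := interior_cone_large K_cone Kk (y + L x - p).
exists t => l l0; exists 1 => //; rewrite /= scale1r mul1r.
have := Phi_mono (l *: (- s)); rewrite scalerN opprK => /(_ (S_cone.2 _ _ l0 Ss)).
rewrite Phi_x0; case Phi_xs: (Phi _) (@Phi_ninfty (x, - (l *: s))) => [w||];
  [move=> _ /leK_EFin Kw|by []|by move=> /(_ erefl)].
exists x, w; split => //=.
have -> : y + t *: k + L x - w = y + L x - p + t *: k + (p - w)
  by lincomb R Y; ring.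
by apply: interior_coneD => //; exact: tK.
Qed.

End FixedInfimum.

Lemma stable_strong_duality_D_of_multipliers :
  (forall (L : {linear X -> Y}) y k, continuous L -> interior K k ->
    WInfP K Phi L y%:E -> exists h, multiplier K Phi L y k h) ->
  stable_strong_duality_D K Phi.
Proof.
move=> ex_h L L_cont; have [k Kk] := K_int.
apply: primal_value_eq_dual_value => // y y_inf.
have [h hm] := ex_h L y k L_cont Kk y_inf.
have [T [_ LT Ty]] := multiplier_dual Phi_ninfty L_cont y_inf hm.
by exists T.
Qed.

Lemma stable_strong_duality_Dl_of_multipliers :
  (forall (L : {linear X -> Y}) y k, continuous L -> interior K k ->
    WInfP K Phi L y%:E -> exists2 h, multiplier K Phi L y k h &
      forall s, S s -> 0 <= h s) ->
  stable_strong_duality_Dl K S Phi.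
Proof.
move=> ex_h L L_cont; have [k Kk] := K_int.
apply: primal_value_eq_dual_value => // y y_inf.
have [h hm hS] := ex_h L y k L_cont Kk y_inf.
have [T [TE LT Ty]] := multiplier_dual Phi_ninfty L_cont y_inf hm.
exists T => //; split => //; split; first by case: LT.
move=> _ [s /hS + <-]; rewrite TE le_eqVlt => /predU1P[<-|hs0].
  by rewrite scale0r; exact: closed_cone0.
by apply: K_cone.2 => //; exact: interior_subset.
Qed.

End StrongDuality.

Theorem theorem4p4 (R : realType) (X Y Z : tvsType R)
    (K : set Y) (S : set Z) (Phi : X * Z -> \bar Y)
    (X_hausdorff : hausdorff_space X)
    (Y_hausdorff : hausdorff_space Y)
    (Z_hausdorff : hausdorff_space Z)
    (K_proper : K <> [set: Y]) (K_closed : closed K) (K_cone : convex_cone K)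
    (K_int : interior K !=set0)
    (S_neq0 : S !=set0) (S_cone : convex_cone S)
    (Phi_ninfty : forall p, Phi p <> -oo%E)
    (Phi_convex : K_convex K Phi)
    (Phi_0 : pi_dom Phi 0) :
  ([set z - s | z in pi_dom Phi & s in interior S] 0 ->
   (forall x z, domPhi Phi (x, z) -> S z -> leK K (Phi (x, 0)) (Phi (x, z))) ->
   stable_strong_duality_D K Phi /\ stable_strong_duality_Dl K S Phi)
  /\
  (cond1 K Phi \/ cond2 Phi \/ cond3 Phi \/ cond4 K Phi \/ cond5 K Phi ->
   stable_strong_duality_D K Phi /\
   ((exists2 x : X, domPhi Phi (x, 0) &
       forall z, S (- z) -> leK K (Phi (x, z)) (Phi (x, 0))) ->
    stable_strong_duality_Dl K S Phi)).
Proof.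
split=> [dom_int Phi_mono|reg].
  have ex_h (L : {linear X -> Y}) y k : continuous L -> interior K k ->
    WInfP K Phi L y%:E -> exists2 h, multiplier K Phi L y k h &
      forall s, S s -> 0 <= h s.
    by move=> _ Kk y_inf; exact: interior_multiplier.
  split; last exact: stable_strong_duality_Dl_of_multipliers.
  apply: stable_strong_duality_D_of_multipliers => // L y k L_cont Kk y_inf.
  by have [h hm _] := ex_h L y k L_cont Kk y_inf; exists h.
have ex_h (L : {linear X -> Y}) y k : continuous L -> interior K k ->
    WInfP K Phi L y%:E -> exists h, multiplier K Phi L y k h.
  by move=> L_cont Kk y_inf; exact: regular_multiplier.
split; first exact: stable_strong_duality_D_of_multipliers.
move=> slater; apply: stable_strong_duality_Dl_of_multipliers => //.
move=> L y k L_cont Kk y_inf; have [h hm] := ex_h L y k L_cont Kk y_inf.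
by exists h => //; exact: slater_multiplier_nonneg hm slater.
Qed.
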